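(* Let $\mathcal{g} = T_0^{l_0} + T_1^{l_1} + T_2^{l_2}$ be a trinomial with $n_il_{i1}>1$ for all $i=0,1,2$ (i.e. no monomial of $\mathcal{g}$ is linear), and let $R(\mathcal{g}) = \mathbb{K}[T_{ij}]/(\mathcal{g})$ be equipped with the $K$-grading $\deg$. If the algebra $R(\mathcal{g})$ is non-factorial (i.e. not a unique factorization domain), then any nonzero $\deg$-homogeneous locally nilpotent derivation of $R(\mathcal{g})$ is elementary of Type II.
   Context: $\mathbb{K}$ is an algebraically closed field of characteristic zero. A derivation of a $\mathbb{K}$-algebra $R$ is a $\mathbb{K}$-linear map $\delta\colon R\to R$ with $\delta(fg)=\delta(f)g+f\delta(g)$; it is locally nilpotent if for every $f\in R$ there is a positive integer $m$ with $\delta^m(f)=0$. Trinomial algebras. Fix positive integers $n_0,n_1,n_2$, let $n=n_0+n_1+n_2$, and for each $i=0,1,2$ fix a tuple $l_i=(l_{i1},\ldots,l_{in_i})$ of positive integers. In the polynomial algebra $\mathbb{K}[T_{ij}]$ in the $n$ variables $T_{ij}$, $i=0,1,2$, $j=1,\ldots,n_i$, put $T_i^{l_i}=T_{i1}^{l_{i1}}\cdots T_{in_i}^{l_{in_i}}$. A trinomial is a polynomial $\mathcal{g}=T_0^{l_0}+T_1^{l_1}+T_2^{l_2}$ of this form; it is irreducible, and the domain $R(\mathcal{g})=\mathbb{K}[T_{ij}]/(\mathcal{g})$ is called a trinomial algebra. The same notation is used for elements of $\mathbb{K}[T_{ij}]$ and their images in $R(\mathcal{g})$. The grading $\deg$.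 Let $L=\begin{pmatrix}-l_0&l_1&0\\-l_0&0&l_2\end{pmatrix}$ (a $2\times n$ integer matrix), $L^*$ its transpose, $K=\mathbb{Z}^n/\operatorname{Im}L^*$, and $Q\colon\mathbb{Z}^n\to K$ the projection. With $e_{ij}$ the canonical basis vectors of $\mathbb{Z}^n$, setting $\deg T_{ij}=Q(e_{ij})$ defines a $K$-grading on $\mathbb{K}[T_{ij}]$ for which $\mathcal{g}$ is homogeneous, hence a $K$-grading on $R(\mathcal{g})$, denoted $\deg$. A derivation of a graded algebra $R=\bigoplus_{w\in K}R_w$ is homogeneous if it maps homogeneous elements to homogeneous elements (in which case there is $d\in K$ with $\delta(R_w)\subseteq R_{w+d}$ for all $w\in K$). The derivations $\delta_{C,\beta}$. Let $C=(c_0,c_1,c_2)$ with integers $1\le c_i\le n_i$, and let $0\ne\beta=(\beta_0,\beta_1,\beta_2)\in\mathbb{K}^3$ with $\beta_0+\beta_1+\beta_2=0$. Then either all $\beta_i\neq0$ or exactly one $\beta_{i_0}$ is zero. (i) If $\beta_i\ne0$ for all $i$ and there is at most one $i_1$ with $l_{i_1c_{i_1}}>1$, set $\delta_{C,\beta}(T_{ij})=\beta_i\prod_{k\ne i}\frac{\partial T_k^{l_k}}{\partial T_{kc_k}}$ if $j=c_i$, and $\delta_{C,\beta}(T_{ij})=0$ if $j\ne c_i$. (ii) If $\beta_{i_0}=0$ for a unique $i_0$ and there is at most one $i_1\neq i_0$ with $l_{i_1c_{i_1}}>1$, set $\delta_{C,\beta}(T_{ij})=\beta_i\prod_{k\ne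 i,i_0}\frac{\partial T_k^{l_k}}{\partial T_{kc_k}}$ if $j=c_i$, and $\delta_{C,\beta}(T_{ij})=0$ if $j\ne c_i$. By the Leibniz rule these define derivations of $\mathbb{K}[T_{ij}]$ killing $\mathcal{g}$, hence derivations $\delta_{C,\beta}$ of $R(\mathcal{g})$. ($\delta_{C,\beta}$ is defined only when the conditions of (i) or (ii) hold.) A derivation of $R(\mathcal{g})$ is elementary if it has the form $h\delta_{C,\beta}$ with $h\in R(\mathcal{g})$ a $\deg$-homogeneous element of the kernel of $\delta_{C,\beta}$. It is elementary of Type I (resp. Type II) if $\delta_{C,\beta}$ comes from case (i) (resp. case (ii)). *)

(* Defs.v *)
From HB Require Import structures.
From mathcomp Require Import all_boot all_order all_algebra.
From mathcomp Require Import boolp.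
From mathcomp Require Import mpoly.

Set Implicit Arguments.
Unset Strict Implicit.
Unset Printing Implicit Defensive.

Import GRing.Theory.
Local Open Scope ring_scope.
Local Open Scope quotient_scope.

(** * Factorial rings *)

(* The rings below carry no computable inverse, so units, associates and
   irreducible elements are defined propositionally. *)
Section Factorial.
Variable A : comNzRingType.

Definition is_unit (x : A) : Prop := exists y, x * y = 1.

Definition associated (x y : A) : Prop := exists2 u, is_unit u & x = u * y.

Definition irreducible_elt (p : A) : Prop :=
  [/\ p <> 0, ~ is_unit p &
      forall a b, p = a * b -> is_unit a \/ is_unit b].

Definition is_domain : Prop := forall a b : A, a * b = 0 -> a = 0 \/ b = 0.

Definition factorial_ring : Prop :=
  [/\ is_domain,
      forall a : A, a <> 0 -> ~ is_unit a ->
        exists2 s : seq A, {in s, forall p, irreducible_elt p}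
                         & a = \prod_(p <- s) p
    & forall s t : seq A,
        {in s, forall p, irreducible_elt p} ->
        {in t, forall p, irreducible_elt p} ->
        \prod_(p <- s) p = \prod_(p <- t) p ->
        exists2 t' : seq A, perm_eq t t' &
          size s = size t' /\
          forall i, (i < size s)%N -> associated s`_i t'`_i].

End Factorial.

(** * Derivations *)

Definition derivation (F : nzRingType) (A : lalgType F) (d : A -> A) : Prop :=
  linear d /\ forall f g, d (f * g) = d f * g + f * d g.

Definition locally_nilpotent (A : nmodType) (d : A -> A) : Prop :=
  forall f, exists2 m : nat, (0 < m)%N & iter m d f = 0.

(** * Trinomial algebras *)

(* The indices j = 1, ..., n_i are encoded by 'I_(nvars i). *)
Record trinomial_data := TrinomialData {
  nvars : 'I_3 -> nat;
  expo : forall i, 'I_(nvars i) -> nat;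
  nvars_gt0 : forall i, (0 < nvars i)%N;
  expo_gt0 : forall i (j : 'I_(nvars i)), (0 < expo j)%N }.

Definition nb_vars (t : trinomial_data) : nat := (\sum_i nvars t i)%N.

(* The position n_0 + ... + n_{i-1} + j of T_ij among all the variables. *)
Definition vidx t (i : 'I_3) (j : 'I_(nvars t i)) : 'I_(nb_vars t) :=
  tagnat.Rank i j.

Lemma eq_vidx t i k (j : 'I_(nvars t i)) (l : 'I_(nvars t k)) :
  (vidx j == vidx l) = (i == k) && (j == l :> nat).
Proof. by rewrite -(inj_eq val_inj) tagnat.eq_Rank. Qed.

(* The exponent l_{i1}. *)
Definition expo1 (t : trinomial_data) (i : 'I_3) : nat :=
  expo (Ordinal (nvars_gt0 t i)).

Section Polynomials.
Variables (F : fieldType) (t : trinomial_data).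

Definition Tvar (i : 'I_3) (j : 'I_(nvars t i)) : {mpoly F[nb_vars t]} :=
  'X_(vidx j).

Definition Tmon (i : 'I_3) : {mpoly F[nb_vars t]} :=
  \prod_(j < nvars t i) Tvar j ^+ expo j.

Definition trinomial : {mpoly F[nb_vars t]} := \sum_i Tmon i.

Definition trin_ideal : pred {mpoly F[nb_vars t]} :=
  fun f => `[< exists h, f = h * trinomial >].

Lemma trinomial_at0 : trinomial.@[fun=> 0] = 0.
Proof.
rewrite /trinomial raddf_sum /= big1 // => i _.
rewrite /Tmon rmorph_prod /= (bigD1 (Ordinal (nvars_gt0 t i))) //=.
by rewrite rmorphXn /= mevalXU expr0n gtn_eqF ?expo_gt0 ?mul0r.
Qed.

Lemma trin_ideal_closed : idealr_closed trin_ideal.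
Proof.
split.
- by apply/asboolP; exists 0; rewrite mul0r.
- apply/negP => /asboolP [h /(congr1 (meval (fun=> 0)))].
  rewrite rmorphM /= trinomial_at0 mulr0 rmorph1 => /eqP.
  by rewrite oner_eq0.
- move=> a u v /asboolP [h ->] /asboolP [h' ->]; apply/asboolP.
  by exists (a * h + h'); rewrite mulrDl mulrA.
Qed.

HB.instance Definition _ := isIdealr.Build _ trin_ideal trin_ideal_closed.

Definition trin_idealr : idealr {mpoly F[nb_vars t]} := trin_ideal.

Definition trin_alg : Type := {ideal_quot trin_idealr}.

HB.instance Definition _ := GRing.ComNzRing.on trin_alg.

Definition trin_pi (f : {mpoly F[nb_vars t]}) : trin_alg :=
  \pi_({ideal_quot trin_idealr}) f.

Lemma trin_piD f g : trin_pi (f + g) = trin_pi f + trin_pi g.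
Proof. exact: (rmorphD (\pi_({ideal_quot trin_idealr}))). Qed.

Lemma trin_piM f g : trin_pi (f * g) = trin_pi f * trin_pi g.
Proof. exact: (rmorphM (\pi_({ideal_quot trin_idealr}))). Qed.

Lemma trin_pi1 : trin_pi 1 = 1.
Proof. exact: (rmorph1 (\pi_({ideal_quot trin_idealr}))). Qed.

Lemma trin_pi_eqP f g :
  reflect (exists h, f - g = h * trinomial) (trin_pi f == trin_pi g).
Proof. by rewrite /trin_pi -Quotient.idealrBE; apply: asboolP. Qed.

Lemma trin_reprK (x : trin_alg) : trin_pi (repr x) = x.
Proof. exact: reprK. Qed.

Definition trin_scale (a : F) (x : trin_alg) : trin_alg := trin_pi a%:MP * x.

Lemma trin_scaleA a b x :
  trin_scale a (trin_scale b x) = trin_scale (a * b) x.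
Proof. by rewrite /trin_scale mpolyCM trin_piM mulrA. Qed.

Lemma trin_scale1 : left_id 1 trin_scale.
Proof. by move=> x; rewrite /trin_scale trin_pi1 mul1r. Qed.

Lemma trin_scaleDr : right_distributive trin_scale +%R.
Proof. by move=> a x y; rewrite /trin_scale mulrDr. Qed.

Lemma trin_scaleDl x : {morph trin_scale^~ x : a b / a + b}.
Proof. by move=> a b; rewrite /trin_scale mpolyCD trin_piD mulrDl. Qed.

HB.instance Definition _ := GRing.Zmodule_isLmodule.Build F trin_alg
  trin_scaleA trin_scale1 trin_scaleDr trin_scaleDl.

Lemma trin_scaleAl (a : F) (x y : trin_alg) : a *: (x * y) = a *: x * y.
Proof. by rewrite /GRing.scale /= /trin_scale mulrA. Qed.

HB.instance Definition _ := GRing.Lmodule_isLalgebra.Build F trin_alg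
  trin_scaleAl.

Lemma trin_piZ a f : trin_pi (a *: f) = a *: trin_pi f.
Proof. by rewrite -mul_mpolyC trin_piM. Qed.

End Polynomials.

(** * The grading *)

Section Grading.
Variable t : trinomial_data.

(* Rows r = 0, 1 have the blocks -l_0, and l_{r+1} in position r + 1. *)
Definition Lmat : 'M[int]_(2, nb_vars t) :=
  \mxrow_(i < 3) \matrix_(r < 2, j < nvars t i)
    (if i == ord0 then - (expo j)%:Z
     else if i == lift ord0 r then (expo j)%:Z else 0).

Lemma LmatE r i (j : 'I_(nvars t i)) :
  Lmat r (vidx j) = if i == ord0 then - (expo j)%:Z
                    else if i == lift ord0 r then (expo j)%:Z else 0.
Proof.
have /matrixP/(_ r j) := @mxrowK _ _ _ _ (fun i : 'I_3 =>
  \matrix_(r < 2, j < nvars t i) (if i == ord0 then - (expo j)%:Z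
     else if i == lift ord0 r then (expo j)%:Z else 0)) i.
by rewrite !mxE.
Qed.

Definition imLT : pred 'cV[int]_(nb_vars t) :=
  fun v => `[< exists u : 'cV[int]_2, v = Lmat^T *m u >].

Lemma imLT_zmod_closed : zmod_closed imLT.
Proof.
split; first by apply/asboolP; exists 0; rewrite mulmx0.
move=> u v /asboolP [a ->] /asboolP [b ->]; apply/asboolP.
by exists (a - b); rewrite mulmxBr.
Qed.

HB.instance Definition _ := GRing.isZmodClosed.Build 'cV[int]_(nb_vars t) imLT
  imLT_zmod_closed.

Definition imLT_zmod : zmodClosed 'cV[int]_(nb_vars t) :=
  GRing.ZmodClosed.clone _ imLT _.

Definition grading_group : zmodType := Quotient.quot imLT_zmod.

Definition gradQ (v : 'cV[int]_(nb_vars t)) : grading_group :=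
  \pi_(Quotient.quot imLT_zmod) v.

Definition mon_deg (m : 'X_{1..nb_vars t}) : grading_group :=
  \sum_(k < nb_vars t) gradQ (delta_mx k 0) *+ m k.

Variable F : fieldType.

Definition mpoly_component (w : grading_group) (f : {mpoly F[nb_vars t]}) :=
  all (fun m => mon_deg m == w) (msupp f).

Definition component (w : grading_group) (x : trin_alg F t) : Prop :=
  exists2 f, mpoly_component w f & x = trin_pi f.

Definition homogeneous (x : trin_alg F t) : Prop := exists w, component w x.

Definition homogeneous_derivation (d : trin_alg F t -> trin_alg F t) : Prop :=
  derivation d /\ forall x, homogeneous x -> homogeneous (d x).

End Grading.

(** * The derivations delta_{C,beta} *)

Section Elementary.
Variables (F : fieldType) (t : trinomial_data).
Variables (C : forall i, 'I_(nvars t i)) (beta : 'I_3 -> F).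

(* The value beta_i prod_k dT_k^{l_k}/dT_{k c_k} of delta_{C,beta} at
   T_{i c_i}.  When no beta_k vanishes, k ranges over all k != i; when beta_{i0}
   is the only one that vanishes, k ranges over all k != i, i0. *)
Definition delta_val (i : 'I_3) : {mpoly F[nb_vars t]} :=
  beta i *: \prod_(k < 3 | (k != i) && (beta k != 0))
              (Tmon F t k)^`M(vidx (C k)).

Definition delta_poly (f : {mpoly F[nb_vars t]}) : {mpoly F[nb_vars t]} :=
  \sum_(i < 3) delta_val i * f^`M(vidx (C i)).

Definition delta (x : trin_alg F t) : trin_alg F t :=
  trin_pi (delta_poly (repr x)).

Definition type_II_cond : Prop :=
  \sum_i beta i = 0 /\
  exists i0, (forall i, beta i = 0 <-> i = i0) /\
    forall i1 i2, i1 != i0 -> i2 != i0 ->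
      (1 < expo (C i1))%N -> (1 < expo (C i2))%N -> i1 = i2.

Lemma delta_polyT i j :
  delta_poly (Tvar F j) = if j == C i then delta_val i else 0.
Proof.
rewrite /delta_poly [LHS](bigD1 i) //= [X in _ + X]big1 ?addr0 => [|k ki].
  rewrite /Tvar mderivX mnm1E.
  have -> : (vidx j == vidx (C i)) = (j == C i).
    by rewrite eq_vidx eqxx.
  case: eqP => [->|_]; last by rewrite scale0r mulr0.
  by rewrite -[X in 'X_[X - _]]add0m addmK mpolyX0 scale1r mulr1.
rewrite /Tvar mderivX mnm1E eq_vidx eq_sym (negPf ki).
by rewrite scale0r mulr0.
Qed.

Lemma delta_poly_lin : linear delta_poly.
Proof.
move=> a f g; rewrite /delta_poly scaler_sumr -big_split /=.
by apply: eq_bigr => i _; rewrite linearP mulrDr scalerAr.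
Qed.

Lemma delta_polyM f g :
  delta_poly (f * g) = delta_poly f * g + f * delta_poly g.
Proof.
rewrite /delta_poly [in RHS]mulr_suml [in RHS]mulr_sumr -big_split /=.
by apply: eq_bigr => i _; rewrite mderivM mulrDr (mulrCA f) !mulrA.
Qed.

Lemma mderiv_Tmon_neq i k : k != i -> (Tmon F t k)^`M(vidx (C i)) = 0.
Proof.
move=> ki; rewrite /Tmon.
apply: (big_rec (fun p => p^`M(vidx (C i)) = 0)) => [|j p _ IH].
  by rewrite -mpolyC1 mderivC.
rewrite mderivM IH mulr0 addr0.
suff -> : (Tvar F j ^+ expo j)^`M(vidx (C i)) = 0 by rewrite mul0r.
rewrite /Tvar mpolyXn mderivX mulmnE mnm1E eq_vidx.
by rewrite (negPf ki) mul0n scale0r.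
Qed.

Lemma delta_poly_trinomial : \sum_i beta i = 0 -> delta_poly (trinomial F t) = 0.
Proof.
move=> b0; rewrite /delta_poly.
pose P := \prod_(k < 3 | beta k != 0) (Tmon F t k)^`M(vidx (C k)).
transitivity (\sum_i beta i *: P); last by rewrite -scaler_suml b0 scale0r.
apply: eq_bigr => i _; rewrite /delta_val.
have -> : (trinomial F t)^`M(vidx (C i)) =
          (Tmon F t i)^`M(vidx (C i)).
  rewrite /trinomial raddf_sum /= (bigD1 i) //= big1 ?addr0 // => k ki.
  exact: mderiv_Tmon_neq.
have [->|bi] := eqVneq (beta i) 0; first by rewrite !scale0r mul0r.
rewrite /P [in RHS](bigD1 i bi) /= -scalerAl mulrC; congr (_ *: (_ * _)).
by apply: eq_bigl => k; rewrite andbC.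
Qed.

Lemma deltaE f :
  \sum_i beta i = 0 -> delta (trin_pi f) = trin_pi (delta_poly f).
Proof.
move=> b0; rewrite /delta; apply/eqP/trin_pi_eqP.
have /eqP/trin_pi_eqP[h eh] := trin_reprK (trin_pi f).
exists (delta_poly h).
have -> : delta_poly (repr (trin_pi f)) - delta_poly f =
          delta_poly (repr (trin_pi f) - f).
  by rewrite addrC -scaleN1r -delta_poly_lin scaleN1r addrC.
by rewrite eh delta_polyM delta_poly_trinomial // mulr0 addr0.
Qed.

Lemma delta_derivation : \sum_i beta i = 0 -> derivation delta.
Proof.
move=> b0; split=> [a x y|x y].
  rewrite -[x]trin_reprK -[y]trin_reprK -trin_piZ -trin_piD !deltaE //.
  by rewrite delta_poly_lin trin_piD trin_piZ.
rewrite -[x]trin_reprK -[y]trin_reprK -trin_piM !deltaE //.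
by rewrite delta_polyM trin_piD !trin_piM.
Qed.

Lemma deltaT i j : \sum_i beta i = 0 ->
  delta (trin_pi (Tvar F j)) = if j == C i then trin_pi (delta_val i) else 0.
Proof.
move=> b0; rewrite deltaE // delta_polyT; case: ifP => // _.
exact: (rmorph0 (\pi_({ideal_quot (trin_idealr F t)}))).
Qed.

End Elementary.

Definition elementary_type_II (F : fieldType) (t : trinomial_data)
    (d : trin_alg F t -> trin_alg F t) : Prop :=
  exists (C : forall i, 'I_(nvars t i)) (beta : 'I_3 -> F) (h : trin_alg F t),
    [/\ type_II_cond C beta, homogeneous h, delta C beta h = 0 &
        forall x, d x = h * delta C beta x].

(* Main.v *)
From HB Require Import structures.
Require Import Defs.
From mathcomp Require Import all_boot all_order all_algebra.
From mathcomp Require Import boolp ring zify.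
From mathcomp Require Import mpoly.

Set Implicit Arguments.
Unset Strict Implicit.
Unset Printing Implicit Defensive.

Import Order.TTheory GRing.Theory Num.Theory.
Local Open Scope ring_scope.
Local Open Scope quotient_scope.

(** Write [y_i] for the class of the i-th monomial of the trinomial, so that
    [y_0 + y_1 + y_2 = 0] in the trinomial algebra [R], and [nu] for the degree
    function of a locally nilpotent derivation [d]: [nu f] is the last [m] with
    [d^m f <> 0].  Over a domain of characteristic zero [nu] is additive on
    products, so the kernel of [d] contains every divisor of its nonzero
    elements, and [nu (d f) = nu f - 1].  That [R] is a domain follows from
    unique factorization in polynomial rings and Eisenstein's criterion
    ([trinomial_prime]).

    A homogeneous derivation shifts all degrees by one element [w0] of the
    grading group ([homogeneous_shift]).  This forces each block [i] to contain
    at most one variable outside the kernel ([at_most_one_active]).  Indeed, if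
    [x] and [z] are two such variables with exponents [a] and [b], the weights
    [b] for [x], [- a] for [z] and 0 for the other variables factor through the
    grading group.  A homogeneous kernel element of nonzero weight would be
    divisible by [x] or by [z], so it has weight 0; applied to the last nonzero
    iterates of [d] on [x] and on [z], this gives the weight of [w0] two
    opposite signs.  Let [x_i] be the variable of block [i] that may lie outside
    the kernel, [u_i = d x_i], and [E_i = y_i / x_i], so that [d y_i] is a
    nonzero multiple of [E_i u_i].

    If some [u_i] vanishes, say [u_0 = 0], then [d y_1 + d y_2 = 0] gives
    [l_1 E_1 u_1 = - l_2 E_2 u_2], and as monomials in different blocks form a
    regular sequence ([block_monomial_coprime]), [d] is [h] times the derivation
    of Type II attached to the [x_i] ([idle_elementary]).

    Otherwise all [u_i] are nonzero.  A homogeneous element is a monomial times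
    a binary form in [y_0] and [y_1], hence a monomial times linear forms since
    the field is algebraically closed ([component_forms],
    [is_form_linear_factor]).  Comparing weights again, some nonzero linear form
    lies in the kernel ([linear_kernel]), and so the [d y_i] are proportional.
    For [i <> k] this makes [E_k] divide [u_i] and [E_i] divide [u_k]; if the
    exponents of [x_i] and [x_k] were both at least 2, [y_i y_k] would divide
    [d y_i d y_k], whose degree is smaller by 2 ([proportional_expo]).  So two
    of the three blocks contain a variable of exponent 1.  In that case [R] is
    factorial ([trinomial_factorial]): inverting the other variables of one of
    these two blocks turns [R] into a localized polynomial ring, those variables
    are prime in [R], and Nagata's criterion applies.  A nonfactorial [R]
    therefore leaves only Type II. *)

(** * Prime elements and unique factorization *)

Section Divisibility.
Variable A : comNzRingType.
Hypothesis domA : is_domain A.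
Implicit Types (a b c p q u : A).

Definition divides a b : Prop := exists c, b = a * c.

Definition prime_elt p : Prop :=
  [/\ p <> 0, ~ is_unit p &
      forall a b, divides p (a * b) -> divides p a \/ divides p b].

(** The number of prime factors is recorded because it bounds how many primes
    can be divided out of an element, which makes content and factorization
    arguments terminate. *)
Inductive prime_prod : nat -> A -> Prop :=
| PrimeProdUnit u : is_unit u -> prime_prod 0 u
| PrimeProdMul n p a : prime_elt p -> prime_prod n a -> prime_prod n.+1 (p * a).

Lemma domain_neq0 a b : a <> 0 -> b <> 0 -> a * b <> 0.
Proof. by move=> a0 b0 /domA []. Qed.

Lemma domain_mulI a b c : a <> 0 -> a * b = a * c -> b = c.
Proof.
move=> a0 /eqP; rewrite -subr_eq0 -mulrBr => /eqP /domA [//|/eqP].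
by rewrite subr_eq0 => /eqP.
Qed.

Lemma divides_refl a : divides a a.
Proof. by exists 1; rewrite mulr1. Qed.

Lemma divides_trans a b c : divides a b -> divides b c -> divides a c.
Proof. by move=> [x ->] [y ->]; exists (x * y); rewrite mulrA. Qed.

Lemma divides_mulr a b c : divides a b -> divides a (b * c).
Proof. by move=> [x ->]; exists (x * c); rewrite mulrA. Qed.

Lemma divides_mull a b c : divides a b -> divides a (c * b).
Proof. by rewrite mulrC; apply: divides_mulr. Qed.

Lemma dividesD a b c : divides a b -> divides a c -> divides a (b + c).
Proof. by move=> [x ->] [y ->]; exists (x + y); rewrite mulrDr. Qed.

Lemma dividesN a b : divides a b -> divides a (- b).
Proof. by move=> [x ->]; exists (- x); rewrite mulrN. Qed.

Lemma divides0 a : divides a 0.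
Proof. by exists 0; rewrite mulr0. Qed.

Lemma divides_addr a b c : divides a (b + c) -> divides a b -> divides a c.
Proof.
by move=> abc /dividesN ab; have := dividesD ab abc; rewrite addKr.
Qed.

Lemma is_unitM a b : is_unit a -> is_unit b -> is_unit (a * b).
Proof. by move=> [x ax] [y yb]; exists (x * y); rewrite mulrACA ax yb mulr1. Qed.

Lemma is_unit_mull a b : is_unit (a * b) -> is_unit a.
Proof. by move=> [x abx]; exists (b * x); rewrite mulrA. Qed.

Lemma is_unit1 : is_unit (1 : A).
Proof. by exists 1; rewrite mulr1. Qed.

Lemma is_unit_neq0 a : is_unit a -> a <> 0.
Proof. by move=> [x + a0]; rewrite a0 mul0r => /esym/eqP; rewrite oner_eq0. Qed.

Lemma prime_elt_unit p u : prime_elt p -> is_unit u -> prime_elt (p * u).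
Proof.
move=> [p0 pU pP] uU; split.
- exact: domain_neq0 (is_unit_neq0 uU).
- by move=> /is_unit_mull.
have pu a : divides p a -> divides (p * u) a.
  case: uU => v uv [c ->]; exists (v * c).
  by rewrite mulrA -[p * u * v]mulrA uv mulr1.
move=> a b [c abE]; case: (pP a b) => [|/pu|/pu]; [|by left|by right].
by exists (u * c); rewrite abE mulrA.
Qed.

Lemma prime_prod_neq0 n a : prime_prod n a -> a <> 0.
Proof.
elim=> [u /is_unit_neq0 //|m p b [p0 _ _] _ b0]; exact: domain_neq0.
Qed.

Lemma prime_prod0 a : prime_prod 0 a -> is_unit a.
Proof. by move=> aP; inversion aP. Qed.

Lemma prime_prodZ n a u : is_unit u -> prime_prod n a -> prime_prod n (u * a).
Proof.
move=> uU; elim=> [v vU|m p b pP _ IH]; first by constructor; apply: is_unitM.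
by rewrite mulrCA; constructor.
Qed.

Lemma prime_prodM m n a b :
  prime_prod m a -> prime_prod n b -> prime_prod (m + n) (a * b).
Proof.
elim=> [u uU|k p c pP _ IH] bP; first exact: prime_prodZ.
by rewrite addSn -mulrA; constructor => //; apply: IH.
Qed.

Lemma prime_prod1 p : prime_elt p -> prime_prod 1 p.
Proof. by move=> pP; rewrite -[p]mulr1; constructor=> //; constructor; apply: is_unit1. Qed.

(** Writing [q = p u], the prime [q] divides [p] or [u]; the latter would make
    [p] a unit, so [p] and [q] divide each other. *)
Lemma prime_dvd_prime p q : prime_elt p -> prime_elt q -> divides p q ->
  exists2 u, is_unit u & q = p * u.
Proof.
move=> [p0 pU _] [q0 _ qP] [u quE]; exists u => //.
have [] := qP p u; first by exists 1; rewrite mulr1 quE.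
- move=> [v pE]; exists v; apply: (domain_mulI p0).
  by rewrite mulr1 {2}pE quE !mulrA.
- move=> [v uE]; case: pU; exists v; apply: (domain_mulI q0).
  by rewrite mulr1 {2}quE uE !mulrA [p * q]mulrC.
Qed.

(** Either [p] is associated with the first prime of the product, or it divides
    the product of the others and the induction applies. *)
Lemma prime_prod_div n a p b : prime_prod n a -> prime_elt p -> a = p * b ->
  exists2 m, n = m.+1 & prime_prod m b.
Proof.
move=> aP pP; elim: aP b => [u uU|m q c qP cP IH] b.
  by move=> uE; have [_ []] := pP; move: uU; rewrite uE => /is_unit_mull.
move=> qcE; have [p0 _ pM] := pP; exists m => //.
have [|pq|[d cE]] := pM q c; first by exists b.
  have [u uU qE] := prime_dvd_prime pP qP pq.
  suff -> : b = u * c by apply: prime_prodZ.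
  by apply: (domain_mulI p0); rewrite mulrA -qE.
have [k mE dP] := IH _ cE.
suff -> : b = q * d by rewrite mE; constructor.
by apply: (domain_mulI p0); rewrite -qcE cE mulrCA.
Qed.

(** Each prime of the product divides one of the two cofactors and can be moved
    there, so factorizations descend to divisors. *)
Lemma prime_prod_dvd n a b c : prime_prod n a -> a = b * c ->
  exists m, prime_prod m b.
Proof.
move=> aP; elim: aP b c => [u uU|m p d pP dP IH] b c.
  by move=> uE; exists 0%N; constructor; move: uU; rewrite uE => /is_unit_mull.
have [p0 _ pM] := pP => pdE.
have [|[e bE]|[e cE]] := pM b c; first by exists d.
  have [k kP] : exists k, prime_prod k e.
    by apply: (IH e c); apply: (domain_mulI p0); rewrite mulrA -bE.
  by exists k.+1; rewrite bE; constructor.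
by apply: (IH b e); apply: (domain_mulI p0); rewrite pdE cE mulrCA.
Qed.

Lemma prime_prod_nonunit n a : prime_prod n a -> ~ is_unit a ->
  exists2 p, prime_elt p & divides p a.
Proof. by case=> // m p b pP _ _; exists p => //; exists b. Qed.

Lemma prime_irreducible p : prime_elt p -> irreducible_elt p.
Proof.
move=> [p0 pU pP]; split=> // a b pE.
have [|[c aE]|[c bE]] := pP a b; first by rewrite -pE; apply: divides_refl.
  right; exists c; apply: (domain_mulI p0).
  by rewrite mulr1 {2}pE aE mulrA mulrAC.
left; exists c; apply: (domain_mulI p0).
by rewrite mulr1 {2}pE bE mulrCA.
Qed.

Lemma irreducible_prime n p : prime_prod n p -> irreducible_elt p -> prime_elt p.
Proof.
case=> [u uU [] //|m q a qP aP] [_ qaU qaP].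
have [//|qU|aU] := qaP q a; first by case: qP.
exact: prime_elt_unit.
Qed.

(** Existence of factorizations into primes; uniqueness is then automatic. *)
Definition prime_factorial : Prop := forall a, a <> 0 -> exists n, prime_prod n a.

Hypothesis factA : prime_factorial.

Lemma irreducible_prime_elt p : irreducible_elt p -> prime_elt p.
Proof.
move=> pI; have [p0 _ _] := pI.
by have [n] := factA p0 => /irreducible_prime; apply.
Qed.

Lemma nonunit_prime_dvd a : a <> 0 -> ~ is_unit a ->
  exists2 p, prime_elt p & divides p a.
Proof. by move=> /factA [n] /prime_prod_nonunit. Qed.

Lemma prime_dvd_prod p (s : seq A) : prime_elt p -> divides p (\prod_(q <- s) q) ->
  exists2 q, q \in s & divides p q.
Proof.
move=> [_ pU pM]; elim: s => [|x s IH].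
  by rewrite big_nil => -[c pc]; case: pU; exists c.
rewrite big_cons => /pM [px|/IH [q qs pq]]; first by exists x; rewrite ?mem_head.
by exists q; rewrite // inE qs orbT.
Qed.

(** The unit [u] is carried along because cancelling a prime of [s] against an
    associate of it in [t] changes the products by a unit. *)
Lemma prime_factorial_unique (s t : seq A) u :
  {in s, forall p, irreducible_elt p} -> {in t, forall p, irreducible_elt p} ->
  is_unit u -> \prod_(p <- s) p = u * \prod_(p <- t) p ->
  exists2 t' : seq A, perm_eq t t' &
    size s = size t' /\ forall i, (i < size s)%N -> associated s`_i t'`_i.
Proof.
elim: s t u => [|p s IH] t u sI tI uU.
  rewrite big_nil; case: t tI => [|q t] tI; first by exists [::].
  rewrite big_cons => E; have [_ []] := tI q (mem_head _ _).
  by exists (u * \prod_(p <- t) p); rewrite mulrCA.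
have pI := sI p (mem_head _ _); have pP := irreducible_prime_elt pI.
have [p0 _ _] := pI.
rewrite big_cons => E.
have [|q qt pq] := @prime_dvd_prod p t pP.
  case: uU => v uv; exists (v * \prod_(p <- s) p).
  by rewrite mulrCA E mulrA [v * u]mulrC uv mul1r.
have [v vU qE] := prime_dvd_prime pP (irreducible_prime_elt (tI q qt)) pq.
have tq := perm_to_rem qt.
have [||||t' tt' [st' At']] := IH (rem q t) (u * v).
- by move=> x xs; apply: sI; rewrite inE xs orbT.
- by move=> x /mem_rem; apply: tI.
- exact: is_unitM.
- apply: (domain_mulI p0); rewrite E (perm_big _ tq) big_cons /= {1}qE.
  by ring.
exists (q :: t'); first by rewrite (permPl tq) perm_cons.
split; first by rewrite /= st'.
case=> [_|i] /=; last by rewrite ltnS; apply: At'.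
case: vU => w vw; exists w; last by rewrite qE mulrCA [w * v]mulrC vw mulr1.
by exists v; rewrite mulrC.
Qed.

Lemma prime_prod_list n a : prime_prod n a -> exists u (s : seq A),
  [/\ is_unit u, {in s, forall p, irreducible_elt p} & a = u * \prod_(p <- s) p].
Proof.
elim=> [u uU|m p b pP _ [u [s [uU sI ->]]]].
  by exists u, [::]; rewrite big_nil mulr1.
exists u, (p :: s); rewrite big_cons mulrCA; split=> // q.
rewrite inE => /orP [/eqP ->|/sI //]; exact: prime_irreducible.
Qed.

Lemma irreducible_elt_unit p u : irreducible_elt p -> is_unit u ->
  irreducible_elt (u * p).
Proof.
move=> pI uU; apply: prime_irreducible; rewrite mulrC.
exact: prime_elt_unit (irreducible_prime_elt pI) uU.
Qed.

Lemma prime_factorial_ring : factorial_ring A.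
Proof.
split=> //.
  move=> a a0 aU; have [n aP] := factA a0.
  have [u [s [uU sI aE]]] := prime_prod_list aP.
  case: s sI aE => [|p s] sI aE.
    by case: aU; rewrite aE big_nil mulr1.
  exists (u * p :: s); last by rewrite aE !big_cons mulrA.
  move=> q; rewrite inE => /orP [/eqP ->|qs]; last by apply: sI; rewrite inE qs orbT.
  exact: irreducible_elt_unit (sI p (mem_head _ _)) uU.
move=> s t sI tI E; apply: (@prime_factorial_unique s t 1) => //.
  exact: is_unit1.
by rewrite mul1r.
Qed.

End Divisibility.

Lemma idomain_is_domain (S : idomainType) : is_domain S.
Proof. by move=> a b /eqP; rewrite mulf_eq0 => /orP [] /eqP ->; [left|right]. Qed.

Section Transport.
Variables (A B : comNzRingType) (f : {rmorphism A -> B}) (g : {rmorphism B -> A}).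
Hypotheses (fK : cancel f g) (gK : cancel g f).

Lemma is_unit_iso a : is_unit (f a) <-> is_unit a.
Proof.
split=> -[b ab]; last by exists (f b); rewrite -rmorphM ab rmorph1.
by exists (g b); apply: (can_inj fK); rewrite rmorphM gK ab rmorph1.
Qed.

Lemma divides_iso a b : divides (f a) (f b) <-> divides a b.
Proof.
split=> -[c E]; last by exists (f c); rewrite E rmorphM.
by exists (g c); apply: (can_inj fK); rewrite rmorphM gK.
Qed.

Lemma prime_elt_iso p : prime_elt (f p) <-> prime_elt p.
Proof.
split=> -[p0 pU pP]; split.
- by move=> pE; case: p0; rewrite pE rmorph0.
- by move/is_unit_iso.
- by move=> a b /divides_iso; rewrite rmorphM => /pP [] /divides_iso; [left|right].
- by move=> /(congr1 g); rewrite fK rmorph0.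
- by move/is_unit_iso.
- move=> a b; rewrite -[a]gK -[b]gK -rmorphM => /divides_iso /pP.
  by case=> /divides_iso; [left|right].
Qed.

Lemma prime_prod_iso n a : prime_prod n a -> prime_prod n (f a).
Proof.
elim=> [u uU|m p b pP _ IH]; first by constructor; apply/is_unit_iso.
by rewrite rmorphM; constructor => //; apply/prime_elt_iso.
Qed.

Lemma prime_factorial_iso : prime_factorial A -> prime_factorial B.
Proof.
move=> AP b b0; have [|n bP] := AP (g b).
  by move=> /(congr1 f); rewrite gK rmorph0.
by exists n; rewrite -[b]gK; apply: prime_prod_iso.
Qed.
End Transport.

(** * Gauss's lemma and Eisenstein's criterion *)

Lemma divides_sum (A : comNzRingType) (I : Type) (r : seq I) (P : pred I)
    (F : I -> A) a :
  (forall i, P i -> divides a (F i)) -> divides a (\sum_(i <- r | P i) F i).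
Proof.
move=> aF; apply: (big_ind (divides a)) => //; [exact: divides0|exact: dividesD].
Qed.

Section Gauss.
Variable S : idomainType.
Implicit Types (a b c : S) (p q f g : {poly S}).

Let domS := @idomain_is_domain S.
Let domP := @idomain_is_domain {poly S}.

Lemma polyC_divides c p : divides c%:P p <-> forall i, divides c p`_i.
Proof.
split=> [[q ->] i|cp]; first by exists q`_i; rewrite coefCM.
have cpi i : exists d, p`_i == c * d by have [d ->] := cp i; exists d.
exists (\poly_(i < size p) xchoose (cpi i)).
apply/polyP => i; rewrite coefCM coef_poly; case: ltnP => ip.
  exact/eqP/(xchooseP (cpi i)).
by rewrite mulr0 nth_default.
Qed.

Lemma is_unit_polyC c : is_unit c%:P <-> is_unit c.
Proof.
split=> [[p cp]|[d cd]]; last by exists d%:P; rewrite -polyCM cd.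
by exists p`_0; rewrite -coefCM cp coef1.
Qed.

Lemma first_nondivisible c p : ~ divides c%:P p ->
  exists i, ~ divides c p`_i /\ forall j, (j < i)%N -> divides c p`_j.
Proof.
move=> /polyC_divides /existsNP [i0 ci0].
have ex : exists i, `[< ~ divides c p`_i >] by exists i0; apply/asboolP.
case: (ex_minnP ex) => i /asboolP ci imin; exists i; split=> // j ji.
by apply: contrapT => cj; move: (imin j); rewrite leqNgt ji => H; apply/negP/H/asboolP.
Qed.

(** In a product of two polynomials not divisible by [c], the first coefficients
    not divisible by [c] multiply to a coefficient not divisible by [c]. *)
Lemma prime_polyC c : prime_elt c -> prime_elt c%:P.
Proof.
move=> [c0 cU cP]; split.
- by move=> /eqP; rewrite polyC_eq0 => /eqP.
- by move/is_unit_polyC.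
move=> p q; apply: contraPP => /not_orP [].
move=> /first_nondivisible [i [ci ilt]] /first_nondivisible [j [cj jlt]].
move=> /polyC_divides /(_ (i + j)%N); rewrite coefM.
have ilt' : (i < (i + j).+1)%N by rewrite ltnS leq_addr.
rewrite (bigD1 (Ordinal ilt')) //= addKn addrC => /divides_addr H.
case: (cP p`_i q`_j) => //; apply: H; apply: divides_sum => k /eqP ki.
case: (ltngtP k i) => [ki'|ki'|ki'].
- exact/divides_mulr/ilt.
- by apply/divides_mull/jlt; have := ltn_ord k; lia.
- by case: ki; apply/val_inj.
Qed.

Definition primitive p : Prop := forall c, prime_elt c -> ~ divides c%:P p.

Hypothesis factS : prime_factorial S.

(** As long as some prime divides [p], divide it out: the leading coefficient
    loses a prime factor each time. *)
Lemma content_exists p : p <> 0 -> exists c q, [/\ c <> 0, p = c%:P * q & primitive q].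
Proof.
move=> p0; have lp0 : lead_coef p <> 0.
  by move=> /eqP; rewrite lead_coef_eq0 => /eqP.
have [n nP] := factS lp0.
elim: n p nP {p0 lp0} => [|n IH] p nP.
  exists 1, p; split; [exact/eqP/oner_neq0|by rewrite mul1r|].
  move=> c [_ cU _] /polyC_divides /(_ (size p).-1) [d lpE]; case: cU.
  by apply: (@is_unit_mull _ _ d); rewrite -lpE; apply: prime_prod0.
have [pp|] := pselect (primitive p).
  by exists 1, p; split; [exact/eqP/oner_neq0|by rewrite mul1r|].
move=> /existsNP [c] /not_implyP [cP] /contrapT [q pE].
have [|m [nm] mP] := @prime_prod_div _ domS _ _ c (lead_coef q) nP cP.
  by rewrite pE lead_coefM lead_coefC.
have [|d [r [d0 qE rP]]] := IH q; first by rewrite nm.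
exists (c * d), r; split=> //; last by rewrite pE qE polyCM mulrA.
by apply: (domain_neq0 domS) => //; case: cP.
Qed.

(** Primes of the content of [c f] stay prime over polynomials and cannot divide
    the primitive [p], so they divide the quotient and cancel. *)
Lemma primitive_divides p f c : primitive p -> c <> 0 ->
  divides p (c%:P * f) -> divides p f.
Proof.
move=> pp /factS [n nP]; elim: nP f => [u [v uv]|m d b dP _ IH] f.
  move=> [q E]; exists (v%:P * q); rewrite mulrCA -E mulrA -polyCM.
  by rewrite [v * u]mulrC uv mul1r.
move=> [q E]; apply: IH.
have [d0 _ dM] := prime_polyC dP.
have [|/pp //|[q' qE]] := dM p q.
  by rewrite -E polyCM -mulrA; apply/divides_mulr/divides_refl.
exists q'; apply: (domain_mulI domP d0).
by rewrite mulrA -polyCM E qE mulrCA.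
Qed.

Lemma primitive_mul_const p c q : p = c%:P * q -> primitive p -> c <> 0 -> is_unit c.
Proof.
move=> pE pp c0; apply: contrapT => cU.
have [d dP [e cE]] := nonunit_prime_dvd factS c0 cU.
by apply: (pp d dP); rewrite pE cE polyCM -mulrA; apply/divides_mulr/divides_refl.
Qed.


(** Let [p] divide [f g].  The gcd of [p] and [f] over the fraction field has a
    primitive multiple [G'] dividing both.  If [G'] is constant, a Bezout
    relation shows that [p] divides a constant multiple of [g]; otherwise [p] is
    [G'] up to a unit and divides [f]. *)
Lemma primitive_prime p : primitive p -> (1 < size p)%N ->
  (forall f g, p = f * g -> (size f <= 1)%N \/ (size g <= 1)%N) -> prime_elt p.
Proof.
move=> pp p1 pI; have p0 : p <> 0 by move=> pE; move: p1; rewrite pE size_poly0.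
have sz_dvd f g : f != 0 -> g != 0 -> (size f <= size (f * g)%R)%N.
  move=> f0 g0; rewrite size_mul //.
  by have := size_poly_gt0 f; have := size_poly_gt0 g; rewrite f0 g0; lia.
split=> //.
  move=> [q pq]; have q0 : q != 0.
    by apply/eqP => q0; move: pq; rewrite q0 mulr0 => /esym/eqP; rewrite oner_eq0.
  have := @sz_dvd p q _ q0; rewrite pq size_poly1 => H.
  by move: p1; rewrite ltnNge H //; apply/eqP.
move=> f g pfg; pose G := gcdp p f.
have /Pdiv.WeakIdomain.dvdpP [[c h] /= c0 E] : G %| p := dvdp_gcdl p f.
have G0 : G <> 0.
  by move=> G0; move: E; rewrite G0 mulr0 => /eqP; rewrite scale_poly_eq0 (negPf c0) => /eqP.
have [d [G' [d0 GE G'p]]] := content_exists G0.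
have [k pE] : divides G' p.
  apply: (@primitive_divides G' p c G'p); first exact/eqP.
  by exists (h * d%:P); rewrite mul_polyC E GE; ring.
have sG : (size G = size G')%N by rewrite GE mul_polyC size_scale //; apply/eqP.
have k0 : k <> 0 by move=> k0; move: p0; rewrite pE k0 mulr0.
have [sG'|sk] := pI _ _ pE.
  have : coprimep p f.
    rewrite /coprimep -/G sG; move: sG'.
    suff : (0 < size G')%N by lia.
    by rewrite size_poly_gt0; apply/eqP => G'0; apply: G0; rewrite GE G'0 mulr0.
  move=> cpf; have [[u v] /eqpP [[x y] /andP [/= x0 y0] uvE]] := Bezoutp p f.
  right; have [w w0 wE] : exists2 w, w <> 0 & gcdp p f = w%:P.
    move: cpf => /eqP /[dup] s1 /eqP /size_poly1P [w w0 wE].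
    by exists w => //; apply/eqP.
  apply: (@primitive_divides p g (y * w) pp).
    by apply/eqP; rewrite mulf_neq0 //; apply/eqP.
  rewrite polyCM -wE mul_polyC -uvE.
  rewrite -mul_polyC.
  have -> : x%:P * (u * p + v * f) * g = p * (x%:P * u * g) + x%:P * v * (f * g).
    by ring.
  by apply: dividesD; [apply/divides_mulr/divides_refl|apply/divides_mull].
left; have kC : k = (k`_0)%:P by apply: size1_polyC.
have /is_unit_polyC kU : is_unit k`_0.
  apply: (@primitive_mul_const p k`_0 G') => //; first by rewrite -kC mulrC.
  by move=> k00; move: k0; rewrite kC k00.
have [m G'f] : divides G' f.
  have /Pdiv.WeakIdomain.dvdpP [[b e] /= b0 fE] : G %| f := dvdp_gcdr p f.
  apply: (@primitive_divides G' f b G'p); first exact/eqP.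
  by exists (e * d%:P); rewrite mul_polyC fE GE; ring.
case: kU => n; rewrite -kC => kn; exists (n * m).
by rewrite G'f pE -[LHS]mul1r -kn; ring.
Qed.

(** Split off the content, then factor the primitive part until no factor has
    smaller positive degree. *)
Theorem prime_factorial_poly : prime_factorial {poly S}.
Proof.
move=> p; have [n] := ubnP (size p); elim: n p => // n IH p sp p0.
have [c [q [c0 pE qp]]] := content_exists p0.
have [k cP] := factS c0.
have cP' : prime_prod k c%:P.
  elim: cP => [u uU|m d b dP _ bP]; first by constructor; apply/is_unit_polyC.
  by rewrite polyCM; constructor => //; apply: prime_polyC.
suff [l qP] : exists l, prime_prod l q.
  by exists (k + l)%N; rewrite pE; apply: prime_prodM.
have q0 : q <> 0 by move=> q0; apply: p0; rewrite pE q0 mulr0.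
have sq : (size q = size p)%N by rewrite pE mul_polyC size_scale //; apply/eqP.
have [q1|q1] := leqP (size q) 1.
  exists 0%N; constructor; rewrite [q]size1_polyC //; apply/is_unit_polyC.
  have E := size1_polyC q1.
  apply: (@primitive_mul_const q _ 1) => //; first by rewrite mulr1.
  by move=> q00; move: q0; rewrite E q00.
have [qI|] := pselect (forall f g, q = f * g -> (size f <= 1)%N \/ (size g <= 1)%N).
  by exists 1%N; apply/prime_prod1/primitive_prime.
move=> /existsNP [f] /existsNP [g] /not_implyP [qE] /not_orP [/negP f1 /negP g1].
have f0 : f != 0 by apply: contra_neq f1 => ->; rewrite size_poly0.
have g0 : g != 0 by apply: contra_neq g1 => ->; rewrite size_poly0.
have := size_mul f0 g0; rewrite -qE sq => sfg; move: f1 g1; rewrite -!ltnNge => f1 g1.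
have drop (x y z w : nat) : (z < w.+1)%N -> z = (x + y).-1 -> (1 < y)%N ->
  (1 < x)%N -> (x < w)%N by lia.
have [||a aP] := IH f; [exact: drop sp sfg g1 f1|exact/eqP|].
have [||b bP] := IH g; [by apply: drop sp _ f1 g1; rewrite addnC|exact/eqP|].
by exists (a + b)%N; rewrite qE; apply: prime_prodM.
Qed.

(** If [c] divides the constant coefficient of [f], where [f g] is the given
    polynomial, the first coefficient of [f] not divisible by [c] produces a
    coefficient of [f g] not divisible by [c]; this can only be the leading one,
    so [g] is constant.  The last hypothesis says that the polynomial is
    primitive, whence it is even prime. *)
Lemma eisenstein_prime (a b : S) c l : (0 < l)%N -> a <> 0 ->
  prime_elt c -> divides c b -> ~ divides (c * c) b ->
  (forall d, prime_elt d -> divides d a -> divides d b -> False) ->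
  prime_elt (a *: 'X^l + b%:P : {poly S}).
Proof.
move=> l0 /eqP a0 cP cb ccb ab.
have [c0 cU cM] := cP.
set p := _ + _.
have pE i : p`_i = (if i == l then a else 0) + (if i == 0%N then b else 0).
  by rewrite coefD coefZ coefXn coefC; case: eqP => _; rewrite ?mulr1 ?mulr0.
have sp : size p = l.+1.
  rewrite size_polyDl size_scale ?size_polyXn //.
  by rewrite (leq_ltn_trans (size_polyC_leq1 _)).
apply: primitive_prime; first 1 last.
- by rewrite sp.
- have main f g : p = f * g -> divides c f`_0 -> (size g <= 1)%N.
    move=> fgE cf0.
    have pc0 : p`_0 = b by rewrite pE (ltn_eqF l0) eqxx add0r.
    have cg0 : ~ divides c g`_0.
      move: cf0 => [x xE] [y yE]; apply: ccb; exists (x * y).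
      by rewrite -pc0 fgE coefM big_ord1 xE yE; ring.
    have [i [ci cj]] : exists i, ~ divides c f`_i /\ forall j, (j < i)%N -> divides c f`_j.
      apply: first_nondivisible => cf.
      have : divides c p`_l.
        rewrite fgE; move: l {sp pE p fgE pc0 l0}.
        exact/polyC_divides/divides_mulr.
      by rewrite pE eqxx (gtn_eqF l0) addr0 => ca; apply: (ab c).
    have cfi : ~ divides c p`_i.
      rewrite fgE coefM big_ord_recr /= subnn addrC.
      rewrite addrC => /divides_addr H; case: (cM f`_i g`_0) => //; apply: H.
      by apply: divides_sum => k _; apply/divides_mulr/cj.
    have il : i = l.
      apply: contrapT => /eqP /negPf il; apply: cfi; rewrite pE il add0r.
      by case: eqP => _ //; apply: divides0.
    have f0 : f != 0 by apply: contra_notN ci => /eqP ->; rewrite coef0; apply: divides0.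
    have g0 : g != 0 by apply: contra_notN cg0 => /eqP ->; rewrite coef0; apply: divides0.
    have := size_mul f0 g0; rewrite -fgE sp -il.
    have : (i < size f)%N.
      by rewrite ltnNge; apply: contra_notN ci => fi; rewrite nth_default //; apply: divides0.
    by lia.
  move=> f g fgE; have [] := cM f`_0 g`_0.
  + by have := pE 0%N; rewrite fgE coef0M (ltn_eqF l0) eqxx add0r => ->.
  + by move=> /(main _ _ fgE); right.
  + by move=> H; left; apply: (main g f) => //; rewrite mulrC.
move=> d dP /polyC_divides dp; apply: (ab d dP).
  by have := dp l; rewrite pE eqxx (gtn_eqF l0) addr0.
by have := dp 0%N; rewrite pE (ltn_eqF l0) eqxx add0r.
Qed.
End Gauss.

(** * Unique factorization in polynomial rings *)

Lemma mpoly_rmorph_ext (R : comNzRingType) (n : nat) (B : comNzRingType)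
    (f g : {rmorphism {mpoly R[n]} -> B}) :
  (forall c, f c%:MP = g c%:MP) -> (forall i, f 'X_i = g 'X_i) -> f =1 g.
Proof.
move=> fgC fgX p; rewrite [p]mpolyE !rmorph_sum; apply: eq_bigr => m _.
rewrite -mul_mpolyC !rmorphM fgC; congr (_ * _).
rewrite mpolyXE_id !rmorph_prod; apply: eq_bigr => i _.
by rewrite !rmorphXn fgX.
Qed.

Section SplitVariable.
Variables (R : idomainType) (n : nat) (k0 : 'I_n).

(** [msplit] and [mmerge] identify polynomials in [n] variables with univariate
    polynomials in the variable [k0] over polynomials in the other ones. *)
Definition split_mvar (k : 'I_n) : {poly {mpoly R[n.-1]}} :=
  if unlift k0 k is Some j then ('X_j)%:P else 'X.

Definition msplit : {mpoly R[n]} -> {poly {mpoly R[n.-1]}} :=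
  mmap (polyC \o @mpolyC n.-1 R) split_mvar.
HB.instance Definition _ := GRing.RMorphism.on msplit.

Definition mwiden_at : {mpoly R[n.-1]} -> {mpoly R[n]} :=
  mmap (@mpolyC n R) (fun j => 'X_(lift k0 j)).
HB.instance Definition _ := GRing.RMorphism.on mwiden_at.

Definition mmerge : {poly {mpoly R[n.-1]}} -> {mpoly R[n]} :=
  horner_eval 'X_k0 \o map_poly mwiden_at.
HB.instance Definition _ := GRing.RMorphism.on mmerge.

Lemma msplitC c : msplit c%:MP = (c%:MP)%:P.
Proof. by rewrite /msplit mmapC. Qed.

Lemma msplitX k : msplit 'X_k = split_mvar k.
Proof. by rewrite /msplit mmapX mmap1U. Qed.

Lemma mwiden_atX j : mwiden_at 'X_j = 'X_(lift k0 j).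
Proof. by rewrite /mwiden_at mmapX mmap1U. Qed.

Lemma mmergeC p : mmerge p%:P = mwiden_at p.
Proof. by rewrite /mmerge /= map_polyC /horner_eval hornerC. Qed.

Lemma mmergeX : mmerge 'X = 'X_k0.
Proof. by rewrite /mmerge /= map_polyX /horner_eval hornerX. Qed.

Lemma msplit_widen p : msplit (mwiden_at p) = p%:P.
Proof.
apply: (mpoly_rmorph_ext (f := msplit \o mwiden_at) (g := polyC)) => /= [c|i].
  by rewrite /mwiden_at mmapC msplitC.
by rewrite mwiden_atX msplitX /split_mvar liftK.
Qed.

Lemma msplitK : cancel msplit mmerge.
Proof.
apply: (mpoly_rmorph_ext (f := mmerge \o msplit) (g := idfun)) => [c|k] /=.
  by rewrite msplitC mmergeC /mwiden_at mmapC.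
rewrite msplitX /split_mvar; case: unliftP => [j ->|->]; last exact: mmergeX.
by rewrite mmergeC mwiden_atX.
Qed.

Lemma mmergeK : cancel mmerge msplit.
Proof.
elim/poly_ind => [|p c IH]; first by rewrite !rmorph0.
rewrite rmorphD rmorphM rmorphD rmorphM /= IH mmergeC msplit_widen mmergeX.
by rewrite msplitX /split_mvar unlift_none.
Qed.
End SplitVariable.

Theorem prime_factorial_mpoly (F : fieldType) n : prime_factorial {mpoly F[n]}.
Proof.
elim: n => [|n IH].
  move=> p p0; exists 0%N; constructor.
  have pE : p = (p@_0%MM)%:MP.
    apply/mpolyP => m; rewrite mcoeffC; have -> : m = 0%MM by apply/mnmP => -[].
    by rewrite eqxx mulr1.
  exists (p@_0%MM)^-1%:MP; rewrite {1}pE -mpolyCM mulfV //.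
  by apply/eqP => c0; apply: p0; rewrite pE c0.
have IH' : prime_factorial {poly {mpoly F[n.+1.-1]}} := prime_factorial_poly IH.
exact: (prime_factorial_iso (@mmergeK F n.+1 ord0) (@msplitK F n.+1 ord0) IH').
Qed.

(** * Prime trinomials and binomials *)

Lemma mpoly_gen_ind (R : comNzRingType) (n : nat) (P : {mpoly R[n]} -> Prop) :
  (forall c, P c%:MP) -> (forall i, P 'X_i) ->
  (forall p q, P p -> P q -> P (p + q)) ->
  (forall p q, P p -> P q -> P (p * q)) -> forall p, P p.
Proof.
move=> PC PX PD PM p; rewrite [p]mpolyE.
apply: (big_ind P); [by rewrite -mpolyC0|exact: PD|].
move=> m _; rewrite -mul_mpolyC; apply: (PM) => //.
rewrite mpolyXE_id; apply: (big_ind P); [by rewrite -mpolyC1|exact: PM|].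
by move=> i _; elim: (m i) => [|k IH]; rewrite ?expr0 -?mpolyC1 // exprS; apply: (PM).
Qed.

Section KillVariable.
Variables (F : fieldType) (n : nat).
Implicit Types (p q : {mpoly F[n]}) (m : 'X_{1..n}).

Let domP := @idomain_is_domain {mpoly F[n]}.

(** Reduction modulo the variable [k], realized as an endomorphism. *)
Definition kill_var (k : 'I_n) : {mpoly F[n]} -> {mpoly F[n]} :=
  mmap (@mpolyC n F) (fun i => if i == k then 0 else 'X_i).
HB.instance Definition _ k := GRing.RMorphism.on (kill_var k).

Lemma kill_varX k i : kill_var k 'X_i = if i == k then 0 else 'X_i.
Proof. by rewrite /kill_var mmapX mmap1U. Qed.

Lemma kill_var_mod k p : exists q, p = kill_var k p + 'X_k * q.
Proof.
elim/mpoly_gen_ind: p => [c|i|p q [p' pE] [q' qE]|p q [p' pE] [q' qE]].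
- by exists 0; rewrite /kill_var mmapC mulr0 addr0.
- rewrite kill_varX; case: eqP => [->|_]; first by exists 1; rewrite mulr1 add0r.
  by exists 0; rewrite mulr0 addr0.
- by exists (p' + q'); rewrite rmorphD {1}pE {1}qE; ring.
- exists (p' * q + kill_var k p * q').
  rewrite rmorphM /=; move: (kill_var k p) (kill_var k q) pE qE => u v -> ->; ring.
Qed.

Lemma divides_var k p : divides 'X_k p <-> kill_var k p = 0.
Proof.
split=> [[q ->]|p0]; first by rewrite rmorphM /= kill_varX eqxx mul0r.
by have [q ->] := kill_var_mod k p; rewrite p0 add0r; exists q.
Qed.

Lemma kill_varXm k m : kill_var k 'X_[m] = if m k == 0%N then 'X_[m] else 0.
Proof.
case: eqP => [mk|/eqP mk]; last first.
  apply/divides_var; exists 'X_[m - U_(k)].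
  by rewrite -mpolyXD addmC submK // lep1mP.
rewrite mpolyXE_id rmorph_prod; apply: eq_bigr => i _.
rewrite rmorphXn /= kill_varX; case: eqP => [->|//].
by rewrite mk !expr0.
Qed.

Lemma mpolyX_neq0 m : 'X_[m] <> 0 :> {mpoly F[n]}.
Proof.
by move=> /(congr1 (mcoeff m)) /eqP; rewrite mcoeffX eqxx mcoeff0 oner_eq0.
Qed.

Lemma divides_varX k m : divides 'X_k ('X_[m] : {mpoly F[n]}) <-> m k <> 0%N.
Proof.
split=> [/divides_var|/eqP/negPf mk].
  by rewrite kill_varXm; case: eqP => // _ /mpolyX_neq0.
by apply/divides_var; rewrite kill_varXm mk.
Qed.

Lemma prime_var k : prime_elt ('X_k : {mpoly F[n]}).
Proof.
split; first exact: mpolyX_neq0.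
  move=> [q /(congr1 (kill_var k)) /eqP].
  by rewrite rmorphM /= kill_varX eqxx mul0r rmorph1 eq_sym oner_eq0.
move=> p q /divides_var; rewrite rmorphM /=.
by move=> /domP [] /divides_var; [left|right].
Qed.

Lemma prime_divides_monomial p m : prime_elt p -> divides p 'X_[m] ->
  exists2 k, m k <> 0%N & divides 'X_k p.
Proof.
move=> pP; have [_ pU pM] := pP; rewrite mpolyXE_id => pm.
have [k [mk pk]] : exists k, m k <> 0%N /\ divides p 'X_k.
  move: pm; apply: (big_ind (fun q => divides p q -> exists k, m k <> 0%N /\ divides p 'X_k)).
  - by move=> [c cE]; case: pU; exists c.
  - by move=> q r qP rP /pM [].
  - move=> i _; case: (m i =P 0%N) => [->|mi]; first by move=> [c cE]; case: pU; exists c.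
    elim: (m i) => [|e IH]; first by move=> [c cE]; case: pU; exists c.
    by rewrite exprS => /pM [pi|/IH //]; exists i.
exists k => //; have [u [v uv] ->] := prime_dvd_prime domP pP (prime_var k) pk.
by exists v; rewrite -mulrA uv mulr1.
Qed.

Definition disjoint_mnm m1 m2 := forall k, m1 k = 0%N \/ m2 k = 0%N.

Section Binomial.
Variables (m1 m2 : 'X_{1..n}).
Hypotheses (d12 : disjoint_mnm m1 m2) (m1_neq0 : exists k, m1 k <> 0%N)
  (m2_neq0 : exists k, m2 k <> 0%N).
Let b : {mpoly F[n]} := 'X_[m1] + 'X_[m2].

Lemma kill_binomial k : kill_var k b <> 0.
Proof.
rewrite rmorphD /= !kill_varXm.
have [k1 m1k] := m1_neq0; have m2k : m2 k1 = 0%N by have [] := d12 k1.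
case: eqP => mk1; case: eqP => mk2; rewrite ?addr0 ?add0r;
  try exact: mpolyX_neq0; last by have [] := d12 k.
move=> /(congr1 (mcoeff m1)) /eqP; rewrite mcoeffD !mcoeffX eqxx mcoeff0.
case: (m2 =P m1) => [m21|_]; last by rewrite addr0 oner_eq0.
by move: m1k; rewrite -m21 m2k.
Qed.

Lemma binomial_neq0 : b <> 0.
Proof. by move=> b0; have [k _] := m1_neq0; apply: (@kill_binomial k); rewrite b0 rmorph0. Qed.

Lemma meval0X m : (exists k, m k <> 0%N) -> ('X_[m] : {mpoly F[n]}).@[fun=> 0] = 0.
Proof.
move=> [k mk]; rewrite mevalX (bigD1 k) //= expr0n; move/eqP/negPf: mk => ->.
by rewrite mul0r.
Qed.

Lemma binomial_nonunit : ~ is_unit b.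
Proof.
move=> [c /(congr1 (meval (fun=> 0))) /eqP].
by rewrite mevalM mevalD !meval0X // addr0 mul0r rmorph1 eq_sym oner_eq0.
Qed.

Lemma prime_monomial_binomial m0 p : prime_elt p -> divides p 'X_[m0] ->
  divides p b -> False.
Proof.
move=> pP /(prime_divides_monomial pP) [k _ kp] pb.
by apply: (@kill_binomial k); apply/divides_var; apply: divides_trans pb.
Qed.

(** Let [p ^ 2] divide the binomial [b].  For a variable [X] of the first
    monomial [X * db/dX] is that monomial times its exponent, and [p] divides
    it; so [p] divides both monomials, which have no common variable. *)
Lemma binomial_squarefree p : [pchar F] =i pred0 -> prime_elt p -> ~ divides (p * p) b.
Proof.
move=> /pcharf0P F0 pP [c bE].
have [k mk1] := m1_neq0; have mk2 : m2 k = 0%N by have [] := d12 k.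
have p1 : divides p 'X_[m1].
  (* the derivative of a multiple of p ^ 2 is a multiple of p *)
  have : divides p ('X_k * b^`M(k)).
    rewrite bE mulrC !mderivM.
    by exists ((p^`M(k) * c + p^`M(k) * c + p * c^`M(k)) * 'X_k); ring.
  rewrite mderivD !mderivX mk2 scale0r addr0 -scalerAr -mpolyXD.
  rewrite addmC submK ?lep1mP; last exact/eqP.
  move=> [d dE]; exists ((m1 k)%:R^-1 *: d).
  by rewrite -scalerAr -dE scalerA mulVf ?scale1r // F0; apply/eqP.
by apply: (prime_monomial_binomial pP p1); rewrite bE -mulrA; apply/divides_mulr/divides_refl.
Qed.
End Binomial.
End KillVariable.

Section RestrictMonomial.
Variables (F : fieldType) (n : nat) (k0 : 'I_n).
Definition mnm_drop (m : 'X_{1..n}) : 'X_{1..n.-1} := [multinom m (lift k0 j) | j < n.-1].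

Lemma msplitXm m : msplit k0 'X_[m] = 'X_[mnm_drop m] *: 'X^(m k0) :> {poly {mpoly F[n.-1]}}.
Proof.
rewrite mpolyXE_id rmorph_prod (@bigD1_ord _ _ _ _ k0) //=.
rewrite rmorphXn /= msplitX /split_mvar unlift_none -mul_polyC mulrC; congr (_ * _).
rewrite mpolyXE_id rmorph_prod; apply: eq_bigr => j _.
by rewrite !rmorphXn /= msplitX /split_mvar liftK mnmE.
Qed.

Lemma mnm_drop_disjoint m1 m2 : disjoint_mnm m1 m2 -> disjoint_mnm (mnm_drop m1) (mnm_drop m2).
Proof. by move=> d12 j; rewrite !mnmE. Qed.

Lemma mnm_drop_neq0 (m : 'X_{1..n}) :
  m k0 = 0%N -> (exists k, m k <> 0%N) -> exists j, mnm_drop m j <> 0%N.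
Proof.
move=> mk0 [k]; case: (unliftP k0 k) => [j ->|->] // mj.
by exists j; rewrite mnmE.
Qed.
End RestrictMonomial.

Section PrimePolynomials.
Variables (F : fieldType) (n : nat).
Implicit Types (m : 'X_{1..n}).

Lemma prime_msplit k0 (p : {mpoly F[n]}) : prime_elt (msplit k0 p) -> prime_elt p.
Proof. by move=> /(prime_elt_iso (@msplitK F n k0) (@mmergeK F n k0)). Qed.

(** As a polynomial in a variable of the first monomial the trinomial is
    [a X^l + b] with [b] a binomial.  Every prime factor of [b] is simple, and no
    prime divides both [b] and a monomial, so that Eisenstein applies. *)
Lemma trinomial_prime m0 m1 m2 : [pchar F] =i pred0 ->
  disjoint_mnm m0 m1 -> disjoint_mnm m0 m2 -> disjoint_mnm m1 m2 ->
  (exists k, m0 k <> 0%N) -> (exists k, m1 k <> 0%N) -> (exists k, m2 k <> 0%N) ->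
  prime_elt ('X_[m0] + ('X_[m1] + 'X_[m2]) : {mpoly F[n]}).
Proof.
move=> F0 d01 d02 d12 [k0 m0k] m1n m2n.
have m1k : m1 k0 = 0%N by have [] := d01 k0.
have m2k : m2 k0 = 0%N by have [] := d02 k0.
have r1n := mnm_drop_neq0 m1k m1n; have r2n := mnm_drop_neq0 m2k m2n.
have r12 := mnm_drop_disjoint k0 d12.
pose factP := @prime_factorial_mpoly F n.-1.
apply: (@prime_msplit k0); rewrite !rmorphD /= !msplitXm m1k m2k expr0 -scalerDl alg_polyC.
have [p pP pb] := nonunit_prime_dvd factP (@binomial_neq0 F _ _ _ r12 r1n)
  (@binomial_nonunit F _ _ _ r1n r2n).
apply: (@eisenstein_prime _ factP _ _ p) => //.
- by rewrite lt0n; apply/eqP.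
- exact: mpolyX_neq0.
- exact: binomial_squarefree.
- by move=> d; apply: prime_monomial_binomial.
Qed.

(** Eisenstein in a variable of the second monomial, for the prime [X_k1], which
    divides the first monomial exactly once. *)
Lemma binomial_prime m1 m2 k1 : disjoint_mnm m1 m2 -> m1 k1 = 1%N ->
  (exists k, m2 k <> 0%N) -> prime_elt ('X_[m1] + 'X_[m2] : {mpoly F[n]}).
Proof.
move=> d12 m1k [k2 m2k]; have m1k2 : m1 k2 = 0%N by have [] := d12 k2.
pose factP := @prime_factorial_mpoly F n.-1.
have [j jE] : exists j, k1 = lift k2 j.
  by case: (unliftP k2 k1) => [j ->|E]; [exists j|move: m1k; rewrite E m1k2].
have rj : mnm_drop k2 m1 j = 1%N by rewrite mnmE -jE.
apply: (@prime_msplit k2); rewrite !rmorphD /= !msplitXm m1k2 expr0 alg_polyC addrC.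
apply: (@eisenstein_prime _ factP _ _ 'X_j).
- by rewrite lt0n; apply/eqP.
- exact: mpolyX_neq0.
- exact: prime_var.
- by apply/divides_varX; rewrite rj.
- move=> [c E]; have : divides 'X_j ('X_[mnm_drop k2 m1 - U_(j)] : {mpoly F[n.-1]}).
    exists c; apply: (domain_mulI (@idomain_is_domain {mpoly F[n.-1]})
      (@mpolyX_neq0 F _ U_(j))).
    by rewrite mulrA -E -mpolyXD addmC submK // lep1mP rj.
  by move=> /divides_varX; rewrite mnmE mnm1E eqxx rj.
- move=> d dP /(prime_divides_monomial dP) [i i2 id] d1.
  have /divides_varX i1 := divides_trans id d1.
  by have [] := mnm_drop_disjoint k2 d12 i.
Qed.
End PrimePolynomials.

(** * The trinomial algebra *)

Section Monomials.
Variable t : trinomial_data.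

Lemma vidx_surj (k : 'I_(nb_vars t)) : exists i (j : 'I_(nvars t i)), k = vidx j.
Proof. by exists (tagnat.sig1 k), (tagnat.sig2 k); rewrite /vidx tagnat.sig2K. Qed.

Definition mon_mnm (i : 'I_3) : 'X_{1..nb_vars t} :=
  (\sum_(j < nvars t i) U_(vidx j) *+ expo j)%MM.

Lemma mon_mnmE i k (l : 'I_(nvars t k)) :
  mon_mnm i (vidx l) = if i == k then expo l else 0%N.
Proof.
rewrite /mon_mnm mnm_sumE; case: (i =P k) => [ik|/eqP/negPf ik]; last first.
  by rewrite big1 // => j _; rewrite mulmnE mnm1E eq_vidx ik.
case: k / ik l => l; rewrite (bigD1 l) //= mulmnE mnm1E eqxx mul1n big1 ?addn0 //.
move=> j /negPf jl; rewrite mulmnE mnm1E eq_vidx eqxx /=.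
by rewrite [_ == _ :> nat]jl.
Qed.

Lemma mon_mnm_disjoint i k : i != k -> disjoint_mnm (mon_mnm i) (mon_mnm k).
Proof.
move=> ik x; have [a [j ->]] := vidx_surj x; rewrite !mon_mnmE; move: (expo j) => e.
case: (i =P a) => [ia|_]; [right|by left].
by rewrite -ia eq_sym (negPf ik).
Qed.

Lemma mon_mnm_neq0 i : exists k, mon_mnm i k <> 0%N.
Proof.
exists (vidx (Ordinal (nvars_gt0 t i))); rewrite mon_mnmE eqxx.
by apply/eqP; rewrite -lt0n expo_gt0.
Qed.

Lemma TmonE (F : fieldType) i : Tmon F t i = 'X_[mon_mnm i].
Proof.
rewrite /Tmon /mon_mnm; elim/big_rec2: _ => [|j m p _ ->]; first by rewrite mpolyX0.
by rewrite mpolyXD /Tvar mpolyXn.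
Qed.

End Monomials.

Lemma ord3_third (i k : 'I_3) : i != k -> exists r : 'I_3, [/\ r != i, r != k &
  forall x, x != i -> x != k -> x = r].
Proof.
move=> ik; have [r] : exists r : 'I_3, (r != i) && (r != k).
  by move: i k ik => [[|[|[|//]]] ?] [[|[|[|//]]] ?] //= _;
    [exists (inord 2)|exists (inord 1)|exists (inord 2)
    |exists (inord 0)|exists (inord 1)|exists (inord 0)];
    rewrite -!val_eqE /= !inordK.
move=> /andP [ri rk]; exists r; split=> // x xi xk; apply/val_inj.
move: ri rk xi xk ik; rewrite -!val_eqE /=.
by have := ltn_ord i; have := ltn_ord k; have := ltn_ord r; have := ltn_ord x; lia.
Qed.

Lemma ord3_sum (V : zmodType) (G : 'I_3 -> V) (i k r : 'I_3) :
  i != k -> r != i -> r != k -> \sum_x G x = G i + (G k + G r).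
Proof.
move=> ik ri rk; rewrite (bigD1 i) //= (bigD1 k) 1?eq_sym //= (bigD1 r) /=; last by rewrite ri.
rewrite big1 ?addr0 // => x /andP [/andP [xi xk] xr].
have [r' [_ _ rP]] := ord3_third ik.
by move: xr; rewrite (rP x) // (rP r) // eqxx.
Qed.

Section TrinomialAlgebra.
Variables (F : fieldType) (F_char0 : [pchar F] =i pred0) (t : trinomial_data).
Local Notation P := {mpoly F[nb_vars t]}.
Local Notation R := (trin_alg F t).
Local Notation g := (trinomial F t).
Local Notation pi := (@trin_pi F t).

Let domP := @idomain_is_domain P.

Lemma trin_pi_is_zmod_morphism : zmod_morphism pi.
Proof. exact: (rmorphB (\pi_({ideal_quot (trin_idealr F t)}))). Qed.
Lemma trin_pi_is_monoid_morphism : monoid_morphism pi.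
Proof. by split; [exact: trin_pi1|exact: trin_piM]. Qed.
HB.instance Definition _ := GRing.isZmodMorphism.Build P R pi trin_pi_is_zmod_morphism.
HB.instance Definition _ := GRing.isMonoidMorphism.Build P R pi trin_pi_is_monoid_morphism.

Lemma trin_surj (x : R) : exists f, x = pi f.
Proof. by exists (repr x); rewrite trin_reprK. Qed.

Lemma trin_pi_eq0 f : pi f = 0 <-> divides g f.
Proof.
rewrite -[0](rmorph0 pi); split=> [/eqP/trin_pi_eqP [h]|[h fE]].
  by rewrite subr0 => ->; exists h; rewrite mulrC.
by apply/eqP/trin_pi_eqP; exists h; rewrite subr0 mulrC.
Qed.

Lemma trinomialE i k r : i != k -> r != i -> r != k ->
  g = 'X_[mon_mnm t i] + ('X_[mon_mnm t k] + 'X_[mon_mnm t r]).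
Proof. by move=> ik ri rk; rewrite /trinomial (ord3_sum _ ik ri rk) !TmonE. Qed.

Lemma trinomial_prime_elt : prime_elt g.
Proof.
rewrite (@trinomialE (inord 0) (inord 1) (inord 2)) -?val_eqE /= ?inordK //.
apply: trinomial_prime => //; try exact: mon_mnm_neq0;
  by apply: mon_mnm_disjoint; rewrite -val_eqE /= !inordK.
Qed.

Lemma trin_domain : is_domain R.
Proof.
move=> a b; have [f ->] := trin_surj a; have [h ->] := trin_surj b.
rewrite -rmorphM => /trin_pi_eq0; have [_ _ gP] := trinomial_prime_elt.
by move=> /gP [] /trin_pi_eq0; [left|right].
Qed.

Lemma trinomial_nonunit : ~ is_unit g.
Proof. by have [] := trinomial_prime_elt. Qed.

(** Both sides say that [f] vanishes modulo the variable [k] and the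
    trinomial. *)
Lemma trin_divides_var k f :
  divides (pi 'X_k) (pi f) <-> divides (kill_var k g) (kill_var k f).
Proof.
split=> [[a]|[q E]].
  have [e ->] := trin_surj a; rewrite -rmorphM => /eqP/trin_pi_eqP [h /(congr1 (kill_var k))].
  rewrite rmorphB !rmorphM /= kill_varX eqxx mul0r subr0 => ->.
  by exists (kill_var k h); rewrite mulrC.
have [f' fE] := kill_var_mod k f; have [g' gE] := kill_var_mod k g.
exists (pi (f' - g' * q)); rewrite -rmorphM; apply/eqP/trin_pi_eqP; exists q.
by rewrite [in LHS]fE E [in RHS]gE; move: (kill_var k g) => u; ring.
Qed.

Lemma kill_trinomial i (j : 'I_(nvars t i)) k r : i != k -> r != i -> r != k ->
  kill_var (vidx j) g = 'X_[mon_mnm t k] + 'X_[mon_mnm t r].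
Proof.
move=> ik ri rk; rewrite (trinomialE ik ri rk) !rmorphD /= !kill_varXm !mon_mnmE eqxx.
rewrite eq_sym in ik.
by rewrite (negPf ik) (negPf ri) !eqxx (gtn_eqF (expo_gt0 j)) add0r.
Qed.

Lemma kill_trinomial_neq0 i (j : 'I_(nvars t i)) : kill_var (vidx j) g <> 0.
Proof.
have [k ik] : exists k, i != k.
  by exists (if i == ord0 then ord_max else ord0); case: (eqVneq i ord0) => [->|].
have [r [ri rk _]] := ord3_third ik.
rewrite (kill_trinomial j ik ri rk).
by apply: binomial_neq0; [apply: mon_mnm_disjoint; rewrite eq_sym|exact: mon_mnm_neq0].
Qed.

Lemma trin_var_neq0 i (j : 'I_(nvars t i)) : pi (Tvar F j) <> 0.
Proof.
move=> /trin_pi_eq0 [q E].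
have : kill_var (vidx j) g * kill_var (vidx j) q = 0.
  by rewrite -rmorphM -E /= kill_varX eqxx.
move=> /domP [/kill_trinomial_neq0 //|/divides_var [h qE]].
apply: trinomial_nonunit; exists h.
by apply: (domain_mulI domP (@mpolyX_neq0 F _ U_(vidx j))); rewrite mulr1 [RHS]E qE; ring.
Qed.

(** Modulo [T_kl] the trinomial becomes the sum of the two other monomials, only
    one of which contains the prime [T_ij]; so [T_ij] divides the multiplier of
    the relation and cancels. *)
Lemma trin_var_regular i (j : 'I_(nvars t i)) k (l : 'I_(nvars t k)) a : i != k ->
  divides (pi (Tvar F l)) (pi (Tvar F j) * a) -> divides (pi (Tvar F l)) a.
Proof.
move=> ik; have [f ->] := trin_surj a; rewrite -rmorphM => /trin_divides_var.
have [r [ri rk _]] := ord3_third ik.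
have ki : k != i by rewrite eq_sym.
rewrite rmorphM /= kill_varX eq_vidx (negPf ik) /= => -[q E].
apply/trin_divides_var.
have [x0 _ xP] := prime_var F (vidx j).
have [|H|[q' qE]] := xP (kill_var (vidx l) g) q; first by exists (kill_var (vidx l) f).
  exfalso; move: H; rewrite (kill_trinomial l ki rk ri) => /divides_addr.
  have xi : divides 'X_(vidx j) ('X_[mon_mnm t i] : P).
    by apply/divides_varX; rewrite mon_mnmE eqxx; apply/eqP; rewrite -lt0n expo_gt0.
  by move=> /(_ xi) /divides_varX; rewrite mon_mnmE (negPf ri).
by exists q'; apply: (domain_mulI domP x0); rewrite E qE; ring.
Qed.

Lemma trin_var_prime i (j : 'I_(nvars t i)) :
  prime_elt (kill_var (vidx j) g) -> prime_elt (pi (Tvar F j)).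
Proof.
move=> [k0 kU kP]; split; first exact: trin_var_neq0.
  move=> [a aE]; have /trin_divides_var [q] : divides (pi (Tvar F j)) (pi 1).
    by exists a; rewrite aE rmorph1.
  by rewrite rmorph1 => E; apply: kU; exists q.
move=> a b; have [f ->] := trin_surj a; have [h ->] := trin_surj b.
rewrite -rmorphM => /trin_divides_var; rewrite rmorphM.
by move=> /kP [] /trin_divides_var; [left|right].
Qed.
End TrinomialAlgebra.

(** * Nagata's criterion *)

Section Nagata.
Variables (S R : comNzRingType) (psi : {rmorphism S -> R}).
Hypotheses (domS : is_domain S) (domR : is_domain R).
Hypothesis psi_inj : injective psi.
Hypothesis factS : prime_factorial S.
Variable M : S -> Prop.
Hypothesis MS : forall c, M c -> prime_elt c.
Hypothesis MR : forall c, M c -> prime_elt (psi c).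

Definition list_prod (A : comNzRingType) (Q : A -> Prop) (a : A) : Prop :=
  exists2 s : seq A, {in s, forall c, Q c} & a = \prod_(c <- s) c.

Hypothesis frac : forall r : R, exists m s, list_prod M m /\ psi m * r = psi s.
Hypothesis bounded : forall r : R, r <> 0 -> exists N, forall s : seq S,
  {in s, forall c, M c} -> divides (psi (\prod_(c <- s) c)) r -> (size s <= N)%N.

Lemma list_prod_cancel (A : comNzRingType) (s : seq A) (a b : A) : is_domain A ->
  {in s, forall c, prime_elt c /\ ~ divides c a} ->
  divides (\prod_(c <- s) c) (a * b) -> divides (\prod_(c <- s) c) b.
Proof.
move=> domA; elim: s b => [|c s IH] b sP.
  by rewrite big_nil => _; exists b; rewrite mul1r.
rewrite big_cons => -[e E]; have [[c0 _ cP] ca] := sP c (mem_head _ _).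
have [|//|[b' bE]] := cP a b; first by rewrite E -mulrA; exists (\prod_(j <- s) j * e).
have [||f b'E] := IH b'.
- by move=> x xs; apply: sP; rewrite inE xs orbT.
- exists e; apply: (domain_mulI domA c0); rewrite [RHS]mulrA -E bE; ring.
by exists f; rewrite bE b'E mulrA.
Qed.

Let Mfree (r : R) := forall c, M c -> ~ divides (psi c) r.

(** The bound on the number of elements of [M] that can be divided out of [r]
    replaces the usual noetherian hypothesis. *)
Lemma Mfree_part r : r <> 0 -> exists m r0, [/\ list_prod M m, r = psi m * r0 & Mfree r0].
Proof.
move=> r0; apply: contrapT => H; have [N NP] := bounded r0.
have [s [sM [q rE] sN]] : exists s : seq S,
    [/\ {in s, forall c, M c}, divides (psi (\prod_(c <- s) c)) r & size s = N.+1].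
  elim: N.+1 => [|k [s [sM [q rE] sk]]].
    by exists [::]; split=> //; rewrite big_nil rmorph1; exists r; rewrite mul1r.
  have [c cM [q' qE]] : exists2 c, M c & divides (psi c) q.
    apply: contrapT => Hq; apply: H; exists (\prod_(c <- s) c), q.
    split=> //; first by exists s.
    by move=> c cM cq; apply: Hq; exists c.
  exists (c :: s); split; last by rewrite /= sk.
    by move=> x; rewrite inE => /orP [/eqP -> //|/sM].
  by exists q'; rewrite big_cons rmorphM rE qE; ring.
have : (size s <= N)%N by apply: NP => //; exists q.
by rewrite sN ltnn.
Qed.

Lemma Mfree_cancel m r a : list_prod M m -> Mfree r -> divides r (psi m * a) -> divides r a.
Proof.
move=> [s sM ->] rM [e E].
have mE : psi (\prod_(c <- s) c) = \prod_(c <- map psi s) c by rewrite rmorph_prod big_map.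
have sP : {in map psi s, forall c, prime_elt c /\ ~ divides c r}.
  by move=> _ /mapP [c cs ->]; split; [apply/MR/sM|apply/rM/sM].
have [e' eE] : divides (\prod_(c <- map psi s) c) e.
  by apply: (@list_prod_cancel _ _ r _ domR sP); exists a; rewrite -E mE.
exists e'; apply: (@domain_mulI _ domR (psi (\prod_(c <- s) c))); last first.
  by rewrite E eE mE; ring.
rewrite mE; elim: {E mE eE} (map psi s) sP => [|c l IH] lP.
  by rewrite big_nil; apply/eqP/oner_neq0.
rewrite big_cons; apply: (domain_neq0 domR); first by have [[]] := lP c (mem_head _ _).
by apply: IH => x xl; apply: lP; rewrite inE xl orbT.
Qed.

Lemma list_prodM m m' : list_prod M m -> list_prod M m' -> list_prod M (m * m').
Proof.
move=> [s sM ->] [s' s'M ->]; exists (s ++ s'); last by rewrite big_cat.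
by move=> c; rewrite mem_cat => /orP [/sM|/s'M].
Qed.

Lemma list_prod_prime_prod m : list_prod M m -> exists k, prime_prod k (psi m).
Proof.
move=> [s sM ->]; elim: s sM => [|c s IH] sM.
  by exists 0%N; rewrite big_nil rmorph1; constructor; apply: is_unit1.
have [|k kP] := IH; first by move=> x xs; apply: sM; rewrite inE xs orbT.
by exists k.+1; rewrite big_cons rmorphM; constructor=> //; apply/MR/sM/mem_head.
Qed.

(** If [p] divides an element of [M], it is associated with it and stays prime.
    Otherwise strip all factors in [M] from the image of [p].  What is left is
    prime: clearing denominators turns a divisibility in [R] into one in [S],
    where [p] is prime and prime to the denominators. *)
Lemma prime_psi p : prime_elt p -> exists k, prime_prod k (psi p).
Proof.
move=> pP; have [p0 pU pM] := pP.
have [[c [cM pc]]|pfree] := pselect (exists c, M c /\ divides p c).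
  have [u [v uv] cE] := prime_dvd_prime domS pP (MS cM) pc.
  have -> : p = c * v by rewrite cE -mulrA uv mulr1.
  exists 1%N; rewrite rmorphM; apply: prime_prod1.
  apply: prime_elt_unit => //; first exact: MR.
  by exists (psi u); rewrite -rmorphM mulrC uv rmorph1.
have pm m a : list_prod M m -> divides p (m * a) -> divides p a.
  move=> [s sM ->]; elim: s sM => [|c s IH] sM; first by rewrite big_nil mul1r.
  rewrite big_cons -mulrA => /pM [pc|].
    by case: pfree; exists c; split=> //; apply/sM/mem_head.
  by apply: IH => x xs; apply: sM; rewrite inE xs orbT.
have pp0 : psi p <> 0 by rewrite -(rmorph0 psi) => /psi_inj.
have [m [q [mM pE qM]]] := Mfree_part pp0.
have [k kP] := list_prod_prime_prod mM.
suff qP : prime_elt q.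
  by exists (k + 1)%N; rewrite pE; apply: prime_prodM => //; apply: prime_prod1.
have q0 : q <> 0 by move=> q0; apply: pp0; rewrite pE q0 mulr0.
split=> //.
  move=> [v qv]; have [m' [s [m'M vE]]] := frac v.
  have : p * s = m' * m.
    apply: psi_inj; rewrite !rmorphM pE -vE.
    by transitivity (psi m' * psi m * (q * v)); [ring|rewrite qv mulr1].
  move=> E; have : divides p (m' * (m * 1)) by exists s; rewrite mulr1 E.
  by move=> /(pm _ _ m'M) /(pm _ _ mM) [w pw]; apply: pU; exists w.
move=> a b [c abE].
have [ma [a' [maM aE]]] := frac a; have [mb [b' [mbM bE]]] := frac b.
have [mc [c' [mcM cE]]] := frac c.
have : divides p (mc * (m * (a' * b'))).
  exists (ma * mb * c'); apply: psi_inj; rewrite !rmorphM -aE -bE -cE pE.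
  transitivity (psi mc * psi m * psi ma * psi mb * (a * b)); first by ring.
  by rewrite abE; ring.
have lift x x' mx : list_prod M mx -> psi mx * x = psi x' -> divides p x' -> divides q x.
  move=> mxM E [e x'E]; apply: (Mfree_cancel mxM qM); rewrite E x'E rmorphM pE.
  by exists (psi m * psi e); ring.
move=> /(pm _ _ mcM) /(pm _ _ mM) /pM [pa|pb]; [left|right].
  exact: lift maM aE pa.
exact: lift mbM bE pb.
Qed.

(** Here [psi] makes [R] a subring of the localization of [S] at [M] that
    contains [S]; if all elements of [M] remain prime in [R], then [R] inherits
    unique factorization from [S]. *)
Theorem nagata : prime_factorial R.
Proof.
move=> r r0; have [m [s [mM E]]] := frac r.
have m0 : psi m <> 0 by have [k /prime_prod_neq0] := list_prod_prime_prod mM; apply.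
have s0 : s <> 0.
  by move=> s0; have [] := domain_neq0 domR m0 r0; rewrite E s0 rmorph0.
have [k sP] := factS s0.
have [l lP] : exists l, prime_prod l (psi s).
  elim: sP => [u [v uv]|j p a pP _ [l lP]].
    by exists 0%N; constructor; exists (psi v); rewrite -rmorphM uv rmorph1.
  have [i iP] := prime_psi pP; exists (i + l)%N; rewrite rmorphM.
  exact: prime_prodM.
apply: (prime_prod_dvd domR lP (b := r) (c := psi m)); by rewrite -E mulrC.
Qed.
End Nagata.

(** * Trinomials with two variables of exponent 1 *)

Section DropVariable.
Variables (F : fieldType) (n : nat) (k0 : 'I_n).

Lemma mwiden_at_drop (m : 'X_{1..n}) :
  mwiden_at k0 'X_[mnm_drop k0 m] * 'X_k0 ^+ m k0 = 'X_[m] :> {mpoly F[n]}.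
Proof.
rewrite -[RHS](msplitK k0) msplitXm -mul_polyC rmorphM /= mmergeC.
by rewrite rmorphXn /= mmergeX.
Qed.
End DropVariable.

Lemma polyC_multiple_eq0 (A : idomainType) (a : A) (p q : {poly A}) :
  size p = 2%N -> a%:P = p * q -> a = 0.
Proof.
move=> sp aE; have [q0|q0] := eqVneq q 0.
  by move: aE; rewrite q0 mulr0 => /eqP; rewrite polyC_eq0 => /eqP.
have p0 : p != 0 by rewrite -size_poly_gt0 sp.
have := size_mul p0 q0; have := size_polyC_leq1 a; move: q0.
by rewrite -aE sp -size_poly_gt0; case: (size q) => // e _ /[swap] ->.
Qed.

Section LinearBlock.
Variables (F : fieldType) (t : trinomial_data).
Local Notation n := (nb_vars t).
Local Notation P := {mpoly F[n]}.
Local Notation S := {mpoly F[n.-1]}.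
Local Notation R := (trin_alg F t).
Local Notation g := (trinomial F t).
Local Notation pi := (@trin_pi F t).

Variables (p : 'I_3) (c : 'I_(nvars t p)).
Hypothesis c1 : expo c = 1%N.
Local Notation k0 := (vidx c).

(** The polynomial ring in all variables but [T_c] embeds into [R].  Since [T_c] has exponent 1,
    the relation [T_c * A = - (y_k + y_r)] expresses it as a fraction with
    denominator a monomial [A] in the remaining variables of its block. *)
Definition other_vars : S -> R := pi \o mwiden_at k0.
HB.instance Definition _ := GRing.RMorphism.on other_vars.

Definition block_var (s : S) : Prop :=
  exists2 j : 'I_n.-1, mon_mnm t p (lift k0 j) <> 0%N & s = 'X_j.

(** A multiple of the trinomial, which has degree 1 in [T_c], is zero or
    involves [T_c]. *)
Lemma other_vars_inj : injective other_vars.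
Proof.
move=> s s' /eqP; rewrite -subr_eq0 -rmorphB => /eqP /trin_pi_eq0 [q E].
apply/eqP; rewrite -subr_eq0; apply/eqP.
have sE : (s - s')%:P = msplit k0 g * msplit k0 q by rewrite -rmorphM -E /= msplit_widen.
have [k pk] : exists k, p != k.
  by exists (if p == ord0 then ord_max else ord0); case: (eqVneq p ord0) => [->|].
have [r [rp rk _]] := ord3_third pk.
have sg : size (msplit k0 g) = 2%N.
  rewrite (trinomialE F t pk rp rk) !rmorphD /= !msplitXm !mon_mnmE.
  rewrite eqxx eq_sym (negPf pk) (negPf rp) c1.
  rewrite expr0 -scalerDl alg_polyC size_polyDl size_scale ?size_polyX //;
    try by apply/eqP/mpolyX_neq0.
  exact: leq_ltn_trans (size_polyC_leq1 _) _.
exact: polyC_multiple_eq0 sg sE.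
Qed.

Lemma list_prod1 (A : comNzRingType) (Q : A -> Prop) : list_prod Q 1.
Proof. by exists [::]; rewrite ?big_nil. Qed.

Lemma list_prod_block : list_prod block_var ('X_[mnm_drop k0 (mon_mnm t p)] : S).
Proof.
rewrite mpolyXE_id; apply: (big_ind (list_prod block_var)).
- exact: list_prod1.
- exact: list_prodM.
move=> j _; rewrite mnmE; case E: (mon_mnm t p (lift k0 j)) => [|e]; first exact: list_prod1.
exists (nseq e.+1 'X_j); last by rewrite big_nseq -Monoid.iteropE.
by move=> x /nseqP [-> _]; exists j; rewrite ?E.
Qed.

Lemma other_vars_frac r : exists m s, list_prod block_var m /\ other_vars m * r = other_vars s.
Proof.
have [f ->] := trin_surj r.
elim/mpoly_gen_ind: f =>
  [a|k|f h [m [s [mM E]]] [m' [s' [mM' E']]]|f h [m [s [mM E]]] [m' [s' [mM' E']]]].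
- exists 1, a%:MP; split; first exact: list_prod1.
  by rewrite rmorph1 mul1r /other_vars /= /mwiden_at mmapC.
- case: (unliftP k0 k) => [j ->|->].
    exists 1, 'X_j; split; first exact: list_prod1.
    by rewrite rmorph1 mul1r /other_vars /= mwiden_atX.
  have [k' pk] : exists k, p != k.
    by exists (if p == ord0 then ord_max else ord0); case: (eqVneq p ord0) => [->|].
  have [r' [rp rk _]] := ord3_third pk.
  exists 'X_[mnm_drop k0 (mon_mnm t p)],
    (- ('X_[mnm_drop k0 (mon_mnm t k')] + 'X_[mnm_drop k0 (mon_mnm t r')])).
  split; first exact: list_prod_block.
  have := mwiden_at_drop F k0 (mon_mnm t p); have := mwiden_at_drop F k0 (mon_mnm t k').
  have := mwiden_at_drop F k0 (mon_mnm t r').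
  rewrite !mon_mnmE eqxx (negPf rp) [k' == p]eq_sym (negPf pk) c1 !expr0 !mulr1 expr1.
  rewrite rmorphN rmorphD /= /other_vars /= -rmorphM /= => -> -> ->.
  apply/eqP; rewrite -subr_eq0 opprK -!rmorphD /=; apply/eqP/trin_pi_eq0.
  by rewrite (trinomialE F t pk rp rk); apply: divides_refl.
- exists (m * m'), (m' * s + m * s'); split; first exact: list_prodM.
  by rewrite !rmorphD !rmorphM /= -E -E'; ring.
- exists (m * m'), (s * s'); split; first exact: list_prodM.
  by rewrite !rmorphM /= -E -E'; ring.
Qed.
End LinearBlock.

Section TwoLinearBlocks.
Variables (F : fieldType) (F_char0 : [pchar F] =i pred0) (t : trinomial_data).
Local Notation n := (nb_vars t).
Local Notation S := {mpoly F[n.-1]}.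
Local Notation R := (trin_alg F t).
Local Notation pi := (@trin_pi F t).
Let domR := trin_domain F_char0 (t := t).
Let domS := @idomain_is_domain S.

Variables (p q : 'I_3) (c : 'I_(nvars t p)) (b : 'I_(nvars t q)).
Hypotheses (pq : p != q) (c1 : expo c = 1%N) (b1 : expo b = 1%N).

(** Modulo a variable of block [p] the trinomial becomes the binomial
    [y_q + y_r], in which [T_b] has exponent 1. *)
Lemma block_var_prime (s : S) : block_var c s -> prime_elt (other_vars c s).
Proof.
move=> [j jp ->]; rewrite /other_vars /= mwiden_atX.
move: jp; have [i [l ->]] := vidx_surj (lift (vidx c) j).
rewrite mon_mnmE; case: (p =P i) => // pi _; case: i / pi l => l.
have [r [rp rq _]] := ord3_third pq.
apply: trin_var_prime => //; rewrite (kill_trinomial F l pq rp rq).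
apply: (@binomial_prime _ _ _ _ (vidx b)).
- by apply: mon_mnm_disjoint; rewrite eq_sym.
- by rewrite mon_mnmE eqxx.
- exact: mon_mnm_neq0.
Qed.

(** Use block [q] as the source of denominators instead of block [p].  Then [r]
    becomes a fraction whose denominator only contains variables of block [q],
    so each variable of block [p] dividing [r] divides the numerator [a] and
    lowers its degree. *)
Lemma block_var_bounded (s : seq S) r : {in s, forall x, block_var c x} -> r <> 0 ->
  divides (other_vars c (\prod_(x <- s) x)) r ->
  forall m a : S, list_prod (block_var b) m -> other_vars b m * r = other_vars b a ->
  (size s < msize a)%N.
Proof.
have a_neq0 m a (r' : R) : list_prod (block_var b) m -> r' <> 0 ->
    other_vars b m * r' = other_vars b a -> a <> 0.
  move=> [l lM mE] r'0 E a0; move: E; rewrite a0 rmorph0; apply: domain_neq0 => //.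
  rewrite -(rmorph0 (other_vars b)) => /(other_vars_inj b1) m0.
  move: mE; rewrite m0 => /esym/eqP; rewrite prodf_seq_eq0 => /hasP [_ /lM [j' _ ->]].
  by move=> /eqP /mpolyX_neq0.
elim: s r => [|x s IH] r sM r0 dr m a mM E.
  by rewrite lt0n msize_poly_eq0; apply/eqP; apply: a_neq0 mM r0 E.
have [j jp xE] := sM x (mem_head _ _).
have [j' jj'] : exists j', lift (vidx c) j = lift (vidx b) j'.
  case: (unliftP (vidx b) (lift (vidx c) j)) => [j' ->|jb]; first by exists j'.
  by move: jp; rewrite jb mon_mnmE (negPf pq).
have zE : other_vars c x = other_vars b ('X_j' : S).
  by rewrite xE /other_vars /= !mwiden_atX jj'.
move: dr; rewrite big_cons => -[e]; rewrite rmorphM -mulrA /=.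
move: (erefl (other_vars c (\prod_(y <- s) y) * e)); move: {2 3}(_ * e) => r1 r1E rE.
have r10 : r1 <> 0 by move=> r10; apply: r0; rewrite rE r10 mulr0.
have [m1 [s1 [m1M E1]]] := other_vars_frac b1 r1.
have xP : prime_elt ('X_j' : S) by exact: prime_var.
have [_ _ xM] := xP.
have [|xm1|[a2 aE]] := xM m1 a.
- exists (m * s1); apply: (other_vars_inj b1); rewrite !rmorphM /= -E -E1 rE zE; ring.
- exfalso; case: m1M xm1 => l lM -> /(prime_dvd_prod xP) [y /lM [i ib ->]].
  move=> /divides_varX; rewrite mnm1E; case: eqP => // ij.
  move: jp ib; rewrite jj' ij; have [i' [l' ->]] := vidx_surj (lift (vidx b) j').
  rewrite !mon_mnmE; case: eqP => // pi' _; case: eqP => // qi' _.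
  by move: pq; rewrite pi' qi' eqxx.
have z0 : other_vars b ('X_j' : S) <> 0.
  move=> z0; have : other_vars b ('X_j' : S) = other_vars b 0 by rewrite z0 rmorph0.
  by move=> /(other_vars_inj b1) /mpolyX_neq0.
have E2 : other_vars b m * r1 = other_vars b a2.
  by apply: (domain_mulI domR z0); rewrite -rmorphM /= -aE -E rE zE; ring.
have a20 : a2 != 0 by apply/eqP; apply: a_neq0 mM r10 E2.
rewrite aE msizeM ?msizeX ?mdeg1 //; last exact/eqP/mpolyX_neq0.
rewrite /= ltnS; apply: (IH r1 _ r10 _ _ _ mM E2) => [y ys|].
  by apply: sM; rewrite inE ys orbT.
by exists e.
Qed.

Theorem trinomial_factorial : factorial_ring R.
Proof.
apply: prime_factorial_ring => //.
apply: (@nagata S R (other_vars c) _ _ _ _ (block_var c)) => //.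
- exact: other_vars_inj.
- exact: prime_factorial_mpoly.
- by move=> _ [j _ ->]; exact: prime_var.
- exact: block_var_prime.
- exact: other_vars_frac.
move=> r r0; have [m [a [mM E]]] := other_vars_frac b1 r.
by exists (msize a) => s sM dr; apply/ltnW/(block_var_bounded sM r0 dr mM E).
Qed.
End TwoLinearBlocks.

(** * Locally nilpotent derivations *)

Section LocallyNilpotent.
Variables (A : comNzRingType) (d : A -> A).
Hypothesis domA : is_domain A.
Hypothesis char0A : forall n, n.+1%:R <> 0 :> A.
Hypothesis dD : {morph d : x y / x + y}.
Hypothesis dM : forall x y, d (x * y) = d x * y + x * d y.
Implicit Types f g h : A.

Lemma leibniz0 : d 0 = 0.
Proof. by apply: (addrI (d 0)); rewrite -dD !addr0. Qed.

Lemma leibniz1 : d 1 = 0.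
Proof. by apply: (addrI (d 1)); rewrite addr0 -[in RHS](mulr1 1) dM mulr1 mul1r. Qed.

Lemma leibnizXn f n : d (f ^+ n.+1) = n.+1%:R * (f ^+ n * d f).
Proof.
elim: n => [|n IH]; first by rewrite expr0 !mul1r expr1.
by rewrite exprS dM IH -[n.+2]addn1 natrD exprS; ring.
Qed.

Lemma iter_morphD n f g : iter n d (f + g) = iter n d f + iter n d g.
Proof. by elim: n => //= n ->; rewrite dD. Qed.

Lemma iter_morph0 n : iter n d 0 = 0.
Proof. by elim: n => //= n ->; rewrite leibniz0. Qed.

Lemma iter_eq0 m n f : (m <= n)%N -> iter m d f = 0 -> iter n d f = 0.
Proof. by move=> /subnK <- mf; rewrite iterD mf iter_morph0. Qed.

(** All other terms of the Leibniz formula for [d^(a+b)] differentiate [f] more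
    than [a] times or [g] more than [b] times. *)
Lemma iter_mul a b f g : iter a.+1 d f = 0 -> iter b.+1 d g = 0 ->
  iter (a + b) d (f * g) = iter a d f * iter b d g *+ 'C(a + b, a).
Proof.
have [n] := ubnP (a + b); elim: n a b f g => // n IH [|a] [|b] f g abn fa gb.
- by rewrite bin0.
- have E := IH 0%N b f (d g) abn fa; rewrite -iterSr in E.
  by rewrite add0n iterSr dM [d f]fa mul0r add0r E // -iterSr !bin0.
- have abn' : (a + 0 < n)%N by move: abn; rewrite addSn ltnS.
  have E := IH a 0%N (d f) g abn'; rewrite -iterSr in E.
  by rewrite addSn iterSr dM [d g]gb mulr0 addr0 E // -iterSr addn0 !binn.
have abn1 : (a + b.+1 < n)%N by move: abn; rewrite addSn ltnS.
have abn2 : (a.+1 + b < n)%N by move: abn; rewrite addnS ltnS.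
have E1 := IH a b.+1 (d f) g abn1; rewrite -[iter a.+1 d (d f)]iterSr in E1.
have E2 := IH a.+1 b f (d g) abn2 fa; rewrite -[iter b.+1 d (d g)]iterSr in E2.
rewrite addSn iterSr dM iter_morphD E1 // addnS -addSn E2 //.
by rewrite -!iterSr -mulrnDr [in RHS]binS addnC.
Qed.

(** The degree function of a locally nilpotent derivation. *)
Definition d_order f m : Prop := iter m d f <> 0 /\ iter m.+1 d f = 0.

(** The binomial coefficient of the surviving Leibniz term is nonzero in
    characteristic zero. *)
Lemma d_order_mul f g a b : d_order f a -> d_order g b -> d_order (f * g) (a + b).
Proof.
move=> [fa fa'] [gb gb']; have E := iter_mul fa' gb'; split; rewrite ?iterS E.
  have : ('C(a + b, a) > 0)%N by rewrite bin_gt0 leq_addr.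
  rewrite -mulr_natr; case: 'C(a + b, a) => // n _.
  by do 2?[apply: (domain_neq0 domA) => //].
rewrite -mulr_natr; move: fa' gb'; rewrite !iterS => fa' gb'.
have dn n : d n%:R = 0.
  by elim: n => [|n IH]; rewrite ?leibniz0 // -addn1 natrD dD IH leibniz1 addr0.
by rewrite !dM fa' gb' dn; ring.
Qed.

Lemma d_order_uniq f a b : d_order f a -> d_order f b -> a = b.
Proof.
move=> [fa fa'] [fb fb']; case: (ltngtP a b) => // ab.
  by case: fb; apply: iter_eq0 fa'.
by case: fa; apply: iter_eq0 fb'.
Qed.

Lemma d_order_neq0 f a : d_order f a -> f <> 0.
Proof. by move=> [fa _] f0; apply: fa; rewrite f0 iter_morph0. Qed.

Lemma d_order0 f : f <> 0 -> d f = 0 -> d_order f 0.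
Proof. by []. Qed.

Lemma d_order_d f a : d_order f a.+1 -> d_order (d f) a.
Proof. by move=> [fa fa']; split; rewrite -iterSr. Qed.

Lemma d_order_iter f a : d_order f a -> d_order (iter a d f) 0.
Proof. by move=> [fa fa']; split. Qed.

Hypothesis d_nil : forall f, exists m, iter m d f = 0.

Lemma d_order_exists f : f <> 0 -> exists a, d_order f a.
Proof.
move=> f0; have ex : exists m, iter m d f == 0 by have [m mf] := d_nil f; exists m; apply/eqP.
case: (ex_minnP ex) => [[|m] /eqP mf mmin]; first by [].
by exists m; split=> // /eqP /mmin; rewrite ltnn.
Qed.

Lemma d_order_pos f : d f <> 0 -> exists a, d_order f a.+1.
Proof.
move=> df; have [|[|a] fa] := @d_order_exists f.
- by move=> f0; apply: df; rewrite f0 leibniz0.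
- by case: fa.
- by exists a.
Qed.

Lemma d_kernel_factor f g : f * g <> 0 -> d (f * g) = 0 -> d f = 0.
Proof.
move=> fg0 dfg.
have f0 : f <> 0 by move=> f0; apply: fg0; rewrite f0 mul0r.
have g0 : g <> 0 by move=> g0; apply: fg0; rewrite g0 mulr0.
have [a fa] := d_order_exists f0; have [b gb] := d_order_exists g0.
have /esym /eqP := d_order_uniq (d_order_mul fa gb) (d_order0 fg0 dfg).
by rewrite eq_sym addn_eq0 => /andP [/eqP a0 _]; move: fa; rewrite a0 => -[].
Qed.

Lemma d_kernel_divides f g : g <> 0 -> d g = 0 -> divides f g -> d f = 0.
Proof. by move=> g0 dg [h gE]; apply: (@d_kernel_factor f h); rewrite -gE. Qed.

Lemma d_order_divides f g a b : divides f g -> d_order f a -> d_order g b -> (a <= b)%N.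
Proof.
move=> [h gE] fa gb; have h0 : h <> 0.
  by move=> h0; apply: (d_order_neq0 gb); rewrite gE h0 mulr0.
have [c hc] := d_order_exists h0; rewrite gE in gb.
by rewrite (d_order_uniq gb (d_order_mul fa hc)) leq_addr.
Qed.

(** Outside the kernel, [f | d g] gives [nu f <= nu g - 1], and [g | d f] the
    reverse. *)
Lemma d_cross_divides f g : divides f (d g) -> divides g (d f) -> d f = 0 \/ d g = 0.
Proof.
move=> fg gf; apply: contrapT => /not_orP [df dg].
have [a fa] := d_order_pos df; have [b gb] := d_order_pos dg.
have := d_order_divides fg fa (d_order_d gb).
by have := d_order_divides gf gb (d_order_d fa); lia.
Qed.

Lemma d_self_divides f : divides f (d f) -> d f = 0.
Proof. by move=> H; case: (d_cross_divides H H). Qed.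

End LocallyNilpotent.

(** * The grading group *)

Section Degrees.
Variable t : trinomial_data.
Local Notation n := (nb_vars t).
Local Notation K := (grading_group t).

Lemma sum_vidx (V : nmodType) (G : 'I_n -> V) :
  \sum_k G k = \sum_i \sum_(j < nvars t i) G (vidx j).
Proof.
rewrite (reindex _ (onW_bij _ tagnat.rank_bij)) /= sig_big_dep /=.
by apply: eq_bigr => -[i j] _.
Qed.

Lemma gradQD u v : gradQ (u + v) = gradQ u + gradQ v :> K.
Proof. by rewrite /gradQ raddfD. Qed.

Lemma gradQ_eq u v : gradQ u = gradQ v :> K <-> imLT (u - v).
Proof.
rewrite /gradQ; split=> [/eqP|uv]; first by rewrite -Quotient.idealrBE.
by apply/eqP; rewrite -Quotient.idealrBE.
Qed.

(** The image of the transpose of [L] consists of the integer combinations of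
    the exponent vectors [l_0], [l_1], [l_2] whose coefficients sum to zero. *)
Lemma imLTP (v : 'cV[int]_n) : imLT v <->
  exists2 z : 'I_3 -> int, \sum_i z i = 0 &
    forall i (j : 'I_(nvars t i)), v (vidx j) 0 = z i * (expo j)%:Z.
Proof.
have LE (u : 'cV[int]_2) i (j : 'I_(nvars t i)) :
    ((Lmat t)^T *m u) (vidx j) 0 =
    (if i == ord0 then - (u ord0 0 + u ord_max 0)
     else if i == lift ord0 ord0 then u ord0 0 else u ord_max 0) * (expo j)%:Z.
  rewrite mxE !big_ord_recl big_ord0 addr0 ![_^T _ _]mxE !LmatE; move: (expo j) => e {j}.
  have -> : lift ord0 ord0 = ord_max :> 'I_2 by apply/val_inj.
  case: (i =P ord0) => [_|/eqP i0]; first by ring.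
  have [->|i1] := eqVneq i (lift ord0 ord0).
    by rewrite -[_ == lift ord0 ord_max]val_eqE /=; ring.
  have -> : i = lift ord0 ord_max.
    apply/val_inj; move: i0 i1; rewrite -!val_eqE /= /bump /=; have := ltn_ord i; lia.
  by rewrite eqxx; ring.
split=> [/asboolP [u ->]|[z z0 vE]].
  exists (fun i => if i == ord0 then - (u ord0 0 + u ord_max 0)
     else if i == lift ord0 ord0 then u ord0 0 else u ord_max 0) => //.
  by rewrite !big_ord_recl big_ord0 /=; ring.
apply/asboolP; exists (\col_r z (lift ord0 r)).
apply/colP => k; have [i [j ->]] := vidx_surj k; rewrite vE LE !mxE; congr (_ * _).
have E : z ord0 = - (z (lift ord0 ord0) + z (lift ord0 ord_max)).
  have -> : ord_max = lift ord0 ord0 :> 'I_2 by apply/val_inj.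
  by move: z0; rewrite !big_ord_recl big_ord0 addr0 => /eqP; rewrite addr_eq0 => /eqP.
case: (i =P ord0) => [->//|/eqP i0].
have [->//|i1] := eqVneq i (lift ord0 ord0).
congr z; apply/val_inj; move: i0 i1; rewrite -!val_eqE /= /bump /=; have := ltn_ord i; lia.
Qed.

Definition mnm_col (m : 'X_{1..n}) : 'cV[int]_n := \col_k (m k)%:Z.

Lemma mon_degE m : mon_deg m = gradQ (mnm_col m) :> K.
Proof.
rewrite /mon_deg; have -> : mnm_col m = \sum_k delta_mx k 0 *+ m k.
  apply/colP => k; rewrite mxE summxE (bigD1 k) //= big1 ?addr0 => [|l /negPf lk].
    by rewrite mulmxnE mxE !eqxx; lia.
  by rewrite mulmxnE mxE eq_sym lk mul0rn.
by rewrite /gradQ raddf_sum; apply: eq_bigr => k _; rewrite raddfMn.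
Qed.

Lemma mon_degD m m' : mon_deg (m + m')%MM = mon_deg m + mon_deg m' :> K.
Proof.
rewrite !mon_degE -gradQD; congr gradQ; apply/colP => k.
by rewrite !mxE mnmDE PoszD.
Qed.

Lemma mon_deg0 : mon_deg (0%MM : 'X_{1..n}) = 0 :> K.
Proof. by apply: (addrI (mon_deg (0%MM : 'X_{1..n}) : K)); rewrite -mon_degD addr0 addm0. Qed.

Lemma mon_deg_eqP m m' : mon_deg m = mon_deg m' :> K <->
  exists2 z : 'I_3 -> int, \sum_i z i = 0 &
    forall i (j : 'I_(nvars t i)),
      (m (vidx j))%:Z = (m' (vidx j))%:Z + z i * (expo j)%:Z.
Proof.
rewrite !mon_degE gradQ_eq; split=> [/imLTP [z z0 zE]|[z z0 zE]].
  by exists z => // i j; rewrite -zE !mxE; ring.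
by apply/imLTP; exists z => // i j; rewrite !mxE zE; ring.
Qed.

Lemma mon_deg_mon_mnm i k : mon_deg (mon_mnm t i) = mon_deg (mon_mnm t k) :> K.
Proof.
have [->//|ik] := eqVneq i k; apply/mon_deg_eqP.
exists (fun x => (x == i)%:Z - (x == k)%:Z).
  have [r [ri rk _]] := ord3_third ik; rewrite (ord3_sum _ ik ri rk) !eqxx.
  by rewrite (negPf ik) (negPf ri) (negPf rk) eq_sym (negPf ik); ring.
move=> x j; rewrite !mon_mnmE; rewrite ![x == _]eq_sym.
by case: (i == x); case: (k == x); rewrite /=; lia.
Qed.

Section Weight.
Variables (c : 'I_n -> int) (W : int).
Hypothesis cW : forall i, \sum_(j < nvars t i) c (vidx j) * (expo j)%:Z = W.

(** A linear form on exponents taking the same value [W] on [l_0], [l_1] and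
    [l_2] vanishes on the image of the transpose of [L], so it factors through
    the grading group, and any representative computes it. *)
Definition weight (w : K) : int := \sum_k c k * repr w k 0.

Lemma weight_gradQ v : weight (gradQ v) = \sum_k c k * v k 0.
Proof.
have /gradQ_eq /imLTP [z z0 zE] : gradQ (repr (gradQ v : K)) = gradQ v :> K.
  by rewrite /gradQ reprK.
apply/eqP; rewrite -subr_eq0 /weight -sumrB sum_vidx.
rewrite (eq_bigr (fun i => z i * W)) => [|i _]; first by rewrite -mulr_suml z0 mul0r.
rewrite -(cW i) mulr_sumr; apply: eq_bigr => j _.
by have := zE i j; rewrite !mxE -mulrBr => ->; ring.
Qed.

Lemma weightD w v : weight (w + v) = weight w + weight v.
Proof.
have E (u : K) : u = gradQ (repr u) by rewrite /gradQ reprK.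
rewrite [in LHS](E w) [in LHS](E v) -gradQD weight_gradQ -big_split /=.
by apply: eq_bigr => k _; rewrite mxE mulrDr.
Qed.

Lemma weight0 : weight 0 = 0.
Proof. by apply: (addrI (weight 0)); rewrite -weightD !addr0. Qed.

Lemma weightMn w a : weight (w *+ a) = weight w *+ a.
Proof. by elim: a => [|a IH]; rewrite ?mulr0n ?weight0 // !mulrS weightD IH. Qed.

Lemma weight_mon_deg m : weight (mon_deg m) = \sum_k c k * (m k)%:Z.
Proof. by rewrite mon_degE weight_gradQ; apply: eq_bigr => k _; rewrite mxE. Qed.

Lemma weight_mon_mnm i : weight (mon_deg (mon_mnm t i)) = W.
Proof.
rewrite weight_mon_deg sum_vidx (bigD1 i) //= [X in _ + X]big1 ?addr0 => [|k ki].
  by rewrite -(cW i); apply: eq_bigr => j _; rewrite mon_mnmE eqxx.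
by rewrite big1 // => j _; rewrite mon_mnmE eq_sym (negPf ki) mulr0.
Qed.

Lemma weight_var k : weight (mon_deg U_(k)%MM : K) = c k.
Proof.
rewrite weight_mon_deg (bigD1 k) //= mnm1E eqxx mulr1 big1 ?addr0 // => l lk.
by rewrite mnm1E eq_sym (negPf lk) mulr0.
Qed.
End Weight.
End Degrees.

(** * Homogeneous components *)

Section Components.
Variables (F : fieldType) (F_char0 : [pchar F] =i pred0) (t : trinomial_data).
Local Notation P := {mpoly F[nb_vars t]}.
Local Notation R := (trin_alg F t).
Local Notation K := (grading_group t).
Local Notation g := (trinomial F t).
Local Notation pi := (@trin_pi F t).
Local Notation n := (nb_vars t).

Let domR := trin_domain F_char0 (t := t).

Implicit Types (w v u : K) (x y : R) (m : 'X_{1..n}).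

Definition mproj (w : K) (f : P) : P :=
  \sum_(m <- msupp f | mon_deg m == w) f@_m *: 'X_[m].

Lemma mcoeff_mproj w f m : (mproj w f)@_m = if mon_deg m == w then f@_m else 0.
Proof.
rewrite /mproj raddf_sum /= big_mkcond /=.
have [mf|mf] := boolP (m \in msupp f); last first.
  rewrite (memN_msupp_eq0 mf) if_same big_seq big1 // => m' m'f.
  case: ifP => // _; rewrite mcoeffZ mcoeffX.
  by case: eqP => [mE|_]; [move: mf; rewrite -mE m'f|rewrite mulr0].
rewrite (bigD1_seq m) ?msupp_uniq //= big1 ?addr0 => [|m' /negPf mm'].
  by case: ifP => // _; rewrite mcoeffZ mcoeffX eqxx mulr1.
by case: ifP => // _; rewrite mcoeffZ mcoeffX mm' mulr0.
Qed.

Lemma mpoly_componentP w f : mpoly_component w f <-> mproj w f = f.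
Proof.
split=> [/allP fw|<-].
  apply/mpolyP => m; rewrite mcoeff_mproj; case: ifP => // mw.
  by apply/esym/memN_msupp_eq0; apply: contraFN mw => /fw.
apply/allP => m; rewrite mcoeff_msupp mcoeff_mproj.
by case: ifP => //; rewrite eqxx.
Qed.

Lemma mproj_component w f : mpoly_component w (mproj w f).
Proof.
apply/mpoly_componentP/mpolyP => m; rewrite !mcoeff_mproj.
by case: (_ == _).
Qed.

Lemma mproj_neq w v f : w != v -> mpoly_component w f -> mproj v f = 0.
Proof.
move=> /negPf wv /mpoly_componentP <-; apply/mpolyP => m.
rewrite !mcoeff_mproj mcoeff0; case: eqP => // ->.
by rewrite eq_sym wv.
Qed.

Lemma mprojD w f h : mproj w (f + h) = mproj w f + mproj w h.
Proof.
by apply/mpolyP => m; rewrite mcoeffD !mcoeff_mproj; case: ifP; rewrite ?mcoeffD ?addr0.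
Qed.

Lemma mprojZ w a f : mproj w (a *: f) = a *: mproj w f.
Proof.
by apply/mpolyP => m; rewrite mcoeffZ !mcoeff_mproj; case: ifP; rewrite ?mcoeffZ ?mulr0.
Qed.

Lemma mproj0 w : mproj w 0 = 0.
Proof. by rewrite -[X in mproj _ X](scale0r 0) mprojZ scale0r. Qed.

Lemma mprojB w f h : mproj w (f - h) = mproj w f - mproj w h.
Proof. by rewrite mprojD -scaleN1r mprojZ scaleN1r. Qed.

Lemma mprojX w m : mproj w 'X_[m] = if mon_deg m == w then 'X_[m] else 0.
Proof.
apply/mpolyP => m'; rewrite mcoeff_mproj mcoeffX; case: (m =P m') => [->|mm'].
  by case: ifP; rewrite ?mcoeffX ?eqxx ?mcoeff0.
by rewrite if_same; case: ifP => _; rewrite ?mcoeff0 // mcoeffX; case: eqP.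
Qed.

Lemma mprojMX w f m : mproj w (f * 'X_[m]) = mproj (w - mon_deg m) f * 'X_[m].
Proof.
rewrite [f]mpolyE mulr_suml.
elim: (msupp f) => [|m' s IH]; first by rewrite !big_nil !mproj0 mul0r.
rewrite !big_cons !mprojD mulrDl IH; congr (_ + _).
rewrite -!scalerAl !mprojZ -scalerAl; congr (_ *: _).
rewrite -mpolyXD !mprojX mon_degD eq_sym -subr_eq eq_sym.
by case: ifP; rewrite ?mul0r // mpolyXD.
Qed.

(** The trinomial is homogeneous, hence its ideal is stable under the
    projections. *)
Lemma mproj_trinomial i w f : mproj w (f * g) = mproj (w - mon_deg (mon_mnm t i)) f * g.
Proof.
rewrite /trinomial mulr_sumr [RHS]mulr_sumr.
rewrite (big_morph (mproj w) (mprojD w) (mproj0 w)); apply: eq_bigr => k _.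
by rewrite TmonE mprojMX (mon_deg_mon_mnm t k i).
Qed.

Lemma componentD w x y : component w x -> component w y -> component w (x + y).
Proof.
move=> [f /mpoly_componentP fw ->] [h /mpoly_componentP hw ->].
by exists (f + h); [apply/mpoly_componentP; rewrite mprojD fw hw|rewrite trin_piD].
Qed.

Lemma component0 w : component w (0 : R).
Proof. by exists 0; [apply/mpoly_componentP; rewrite mproj0|rewrite rmorph0]. Qed.

Lemma componentZ w a x : component w x -> component w (a *: x : R).
Proof.
move=> [f /mpoly_componentP fw ->].
by exists (a *: f); [apply/mpoly_componentP; rewrite mprojZ fw|rewrite trin_piZ].
Qed.

Lemma componentX m : component (mon_deg m) (pi 'X_[m]).
Proof. by exists 'X_[m] => //; apply/mpoly_componentP; rewrite mprojX eqxx. Qed.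

Lemma componentM w v x y : component w x -> component v y -> component (w + v) (x * y : R).
Proof.
move=> [f /allP fw ->] [h /allP hv ->]; exists (f * h); last by rewrite trin_piM.
apply/allP => m /msuppM_le /allpairsP [[m1 m2] /= [/fw /eqP <- /hv /eqP <- ->]].
by rewrite mon_degD.
Qed.

Lemma component_pi_eq0 u v (f h : P) : u != v ->
  mpoly_component u f -> mpoly_component v h -> pi (f + h) = 0 -> pi f = 0.
Proof.
move=> uv fu hv /trin_pi_eq0 [q fhE]; apply/trin_pi_eq0.
exists (mproj (u - mon_deg (mon_mnm t ord0)) q).
rewrite mulrC -mproj_trinomial mulrC -fhE mprojD (mproj_neq _ hv); last by rewrite eq_sym.
by rewrite addr0; apply/esym/mpoly_componentP.
Qed.

(** If the degrees of [x] and [y] differed, one of them would differ from [u];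
    projecting the relation between representatives onto it kills [x] or [y]. *)
Lemma component_sum_uniq w v u (x y : R) : component w x -> component v y ->
  component u (x + y) -> x <> 0 -> y <> 0 -> w = v.
Proof.
move=> [f fw ->] [h hv ->] [e eu E] f0 h0; apply: contrapT => /eqP wv.
have [uw|uw] := eqVneq u w.
  apply: h0; rewrite uw in eu; apply: (component_pi_eq0 _ hv (v := w) (h := f - e)).
  - by rewrite eq_sym.
  - apply/mpoly_componentP; move: fw eu => /mpoly_componentP fw /mpoly_componentP eu.
    by rewrite mprojB fw eu.
  - by rewrite rmorphD rmorphB /= -E; ring.
apply: f0; apply/trin_pi_eq0.
have /trin_pi_eq0 [q fhE] : pi (f + h - e) = 0 by rewrite rmorphB rmorphD /= E subrr.
exists (mproj (w - mon_deg (mon_mnm t ord0)) q).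
rewrite mulrC -mproj_trinomial mulrC -fhE mprojB mprojD (mproj_neq uw eu).
rewrite (mproj_neq _ hv) 1?eq_sym // subr0 addr0.
by apply/esym/mpoly_componentP.
Qed.

Lemma pi_monomial_neq0 m : pi 'X_[m] <> 0.
Proof.
rewrite mpolyXE_id rmorph_prod; apply: (big_ind (fun x : R => x <> 0)).
- exact/eqP/oner_neq0.
- by move=> x y; apply: domain_neq0.
move=> k _; rewrite rmorphXn; have [i [j ->]] := vidx_surj k.
elim: (m _) => [|a IH]; first exact/eqP/oner_neq0.
by rewrite exprS; apply: (domain_neq0 domR) => //; apply: trin_var_neq0.
Qed.

Lemma component_div m (y : R) w : component w (pi 'X_[m] * y) ->
  component (w - mon_deg m) y.
Proof.
move=> [f fw E]; have [h yE] := trin_surj y.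
exists (mproj (w - mon_deg m) h); first exact: mproj_component.
apply: (domain_mulI domR (@pi_monomial_neq0 m)).
rewrite E -rmorphM mulrC -mprojMX; apply/eqP; rewrite -subr_eq0 -rmorphB; apply/eqP.
move: E; rewrite yE -rmorphM => /eqP; rewrite eq_sym -subr_eq0 -rmorphB => /eqP.
move=> /trin_pi_eq0 [q fE]; apply/trin_pi_eq0.
exists (mproj (w - mon_deg (mon_mnm t ord0)) q).
rewrite [RHS]mulrC -mproj_trinomial [q * _]mulrC -fE mprojB.
by move/mpoly_componentP: fw => ->; rewrite [h * _]mulrC.
Qed.

Lemma component_divides w k (x : R) : component w x ->
  (forall m, mon_deg m = w -> m k <> 0%N) -> divides (pi 'X_k) x.
Proof.
move=> [f /allP fw ->] mw.
suff [h ->] : divides ('X_k : P) f by exists (pi h); rewrite rmorphM.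
rewrite [f]mpolyE big_seq; apply: divides_sum => m /fw /eqP /mw mk.
rewrite -mul_mpolyC; apply: divides_mull.
exact/divides_varX.
Qed.

End Components.

(** * Homogeneous derivations *)

Section Derivations.
Variables (F : fieldType) (F_char0 : [pchar F] =i pred0) (t : trinomial_data).
Local Notation R := (trin_alg F t).
Local Notation K := (grading_group t).
Local Notation pi := (@trin_pi F t).
Implicit Types (x y : R) (w v : K).

Let domR := trin_domain F_char0 (t := t).

Lemma trin_char0 k : k.+1%:R <> 0 :> R.
Proof.
move=> k0; have : is_unit (k.+1%:R : R).
  have F0 := (pcharf0P F).1 F_char0 k.+1.
  exists (k.+1%:R^-1 *: 1); rewrite mulrC -scalerAl mul1r -scaler_nat scalerA.
  by rewrite mulVf ?scale1r // F0.
by rewrite k0 => -[y /eqP]; rewrite mul0r eq_sym oner_eq0.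
Qed.

Lemma derivation_ext (d e : R -> R) : derivation d -> derivation e ->
  (forall i (j : 'I_(nvars t i)), d (pi (Tvar F j)) = e (pi (Tvar F j))) ->
  forall x, d x = e x.
Proof.
move=> [dL dM] [eL eM] de x; have [f ->] := trin_surj x.
have addL (h : R -> R) : linear h -> {morph h : x y / x + y}.
  by move=> hL u v; rewrite -[u]scale1r hL !scale1r.
have hC (h : R -> R) : linear h -> (forall x y, h (x * y) = h x * y + x * h y) ->
    forall c, h (pi c%:MP) = 0.
  move=> hL hM c; have hD := addL h hL.
  rewrite -alg_mpolyC trin_piZ trin_pi1 -[_ *: _]addr0 hL.
  by rewrite (leibniz1 hM) scaler0 (leibniz0 hD) addr0.
elim/mpoly_gen_ind: f => [c|k|p q IHp IHq|p q IHp IHq].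
- by rewrite !hC.
- by have [i [j ->]] := vidx_surj k; apply: de.
- by rewrite rmorphD /= (addL d dL) (addL e eL) IHp IHq.
- by rewrite rmorphM /= dM eM IHp IHq.
Qed.

Lemma zero_derivation : derivation (fun _ : R => 0).
Proof. by split=> [a x y|x y]; rewrite ?scaler0 ?mul0r ?mulr0 addr0. Qed.

Section HomogeneousDerivation.
Variable d : R -> R.
Hypothesis dH : homogeneous_derivation d.

Lemma derivation_add : {morph d : x y / x + y}.
Proof. by move=> x y; have [[dL _] _] := dH; rewrite -[x]scale1r dL !scale1r. Qed.

Lemma derivation_leibniz x y : d (x * y) = d x * y + x * d y.
Proof. by have [[_ dM] _] := dH; rewrite dM. Qed.

Lemma derivation_scale a x : d (a *: x) = a *: d x.
Proof.
have [[dL _] _] := dH.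
by rewrite -[a *: x]addr0 dL (leibniz0 derivation_add) addr0.
Qed.

(** [d (x y) = d x * y + x * d y] is homogeneous, so its two nonzero terms have
    equal degrees. *)
Lemma homogeneous_shift_uniq w v w' v' x y : component w x -> component v y ->
  component w' (d x) -> component v' (d y) -> d x <> 0 -> d y <> 0 ->
  w' - w = v' - v.
Proof.
move=> xw yv dxw dyv dx0 dy0.
have x0 : x <> 0 by move=> x0; apply: dx0; rewrite x0 (leibniz0 derivation_add).
have y0 : y <> 0 by move=> y0; apply: dy0; rewrite y0 (leibniz0 derivation_add).
have [|u xyu] := dH.2 (x * y); first by exists (w + v); apply: componentM.
rewrite derivation_leibniz in xyu.
have E := component_sum_uniq (componentM dxw yv) (componentM xw dyv) xyu
  (domain_neq0 domR dx0 y0) (domain_neq0 domR x0 dy0).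
by apply/eqP; rewrite subr_eq addrAC eq_sym subr_eq addrC E.
Qed.

Hypothesis d_neq0 : exists x, d x <> 0.

Lemma deriv_var_neq0 : exists i (j : 'I_(nvars t i)), d (pi (Tvar F j)) <> 0.
Proof.
apply: contrapT => H; have [x dx] := d_neq0; apply: dx.
apply: (derivation_ext dH.1 zero_derivation) => i j.
by apply: contrapT => dT; apply: H; exists i, j.
Qed.

Lemma homogeneous_shift : exists w0 : K, forall w x, component w x ->
  component (w + w0) (d x).
Proof.
have [i [j dT0]] := deriv_var_neq0.
have Tw : component (mon_deg U_(vidx j)%MM) (pi (Tvar F j)) by apply: componentX.
have [|v dTv] := dH.2 (pi (Tvar F j)); first by exists (mon_deg U_(vidx j)%MM).
exists (v - mon_deg U_(vidx j)%MM) => w x xw.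
have [->|/eqP dx0] := eqVneq (d x) 0; first exact: component0.
have [|w' dxw] := dH.2 x; first by exists w.
have E := homogeneous_shift_uniq xw Tw dxw dTv dx0 dT0.
by rewrite -E addrC subrK.
Qed.
End HomogeneousDerivation.
End Derivations.

(** * Homogeneous elements as binary forms *)

Section MonomialClasses.
Variables (F : fieldType) (t : trinomial_data).

Definition tmon i : trin_alg F t := trin_pi (Tmon F t i).

Lemma tmon_sum : \sum_i tmon i = 0.
Proof. by rewrite -rmorph_sum; apply/trin_pi_eq0/divides_refl. Qed.

Lemma trin_scalerAr (a : F) (x y : trin_alg F t) : a *: (x * y) = x * (a *: y).
Proof. by rewrite mulrC scalerAl mulrC. Qed.
End MonomialClasses.

Section Forms.
Variables (F : closedFieldType) (t : trinomial_data).
Local Notation R := (trin_alg F t).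
Local Notation K := (grading_group t).
Local Notation pi := (@trin_pi F t).
Implicit Types (p q : {poly F}) (H : R).

Definition idx1 : 'I_3 := lift ord0 (ord0 : 'I_2).
Definition idx2 : 'I_3 := lift ord0 (ord_max : 'I_2).
Local Notation y := (tmon F t).
Local Notation y0 := (y ord0).
Local Notation y1 := (y idx1).

(** The binary form of degree [k] in [y_0] and [y_1] whose dehomogenization is
    [p], truncated to degree [k]. *)
Definition yform k p : R := \sum_(i < k.+1) p`_i *: (y0 ^+ i * y1 ^+ (k - i)).
Definition is_form k H : Prop := exists p, H = yform k p.

Lemma yformD k p q : yform k (p + q) = yform k p + yform k q.
Proof. by rewrite -big_split; apply: eq_bigr => i _; rewrite coefD scalerDl. Qed.

Lemma yformZ k a p : yform k (a *: p) = a *: yform k p.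
Proof. by rewrite scaler_sumr; apply: eq_bigr => i _; rewrite coefZ scalerA. Qed.

Lemma yformMX k p : yform k.+1 (p * 'X) = y0 * yform k p.
Proof.
rewrite /yform big_ord_recl coefMX scale0r add0r mulr_sumr.
apply: eq_bigr => i _; rewrite coefMX /= /bump /= add1n subSS exprS.
by rewrite -mulrA trin_scalerAr.
Qed.

Lemma yform_small k p : (size p <= k.+1)%N -> yform k.+1 p = y1 * yform k p.
Proof.
move=> sp; rewrite /yform big_ord_recr /= nth_default // scale0r addr0 mulr_sumr.
apply: eq_bigr => i _; rewrite subSn ?exprS; last by rewrite -ltnS ltn_ord.
by rewrite -trin_scalerAr; congr (_ *: _); rewrite mulrCA.
Qed.

Lemma yform_take k p : yform k p = yform k (take_poly k.+1 p).
Proof. by apply: eq_bigr => i _; rewrite coef_take_poly ltn_ord. Qed.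

Lemma is_formM_tmon k H i : is_form k H -> is_form k.+1 (y i * H).
Proof.
have f0 p : is_form k.+1 (y0 * yform k p) by exists (p * 'X); rewrite yformMX.
have f1 p : is_form k.+1 (y1 * yform k p).
  exists (take_poly k.+1 p); rewrite yform_small ?size_take_poly //.
  by rewrite -yform_take.
move=> [p ->].
have [->|i0] := eqVneq i ord0; first exact: f0.
have [->|i1] := eqVneq i idx1; first exact: f1.
have [q0 E0] := f0 p; have [q1 E1] := f1 p.
exists (- 1 *: (q0 + q1)); rewrite yformZ yformD -E0 -E1 -mulrDl scalerAl scaleN1r.
congr (_ * _); apply/eqP; rewrite -subr_eq0 opprK addrC -addrA; apply/eqP.
by rewrite -(ord3_sum y (i := ord0) (k := idx1) (r := i)) // tmon_sum.
Qed.

Lemma is_form_tmon_exp k H i a : is_form k H -> is_form (a + k) (y i ^+ a * H).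
Proof.
move=> HF; elim: a => [|a IH]; first by rewrite mul1r.
by rewrite exprS -mulrA; apply: is_formM_tmon.
Qed.

Lemma is_form_sum k (I : eqType) (r : seq I) (a : I -> F) (H : I -> R) :
  {in r, forall i, is_form k (H i)} -> is_form k (\sum_(i <- r) a i *: H i).
Proof.
elim: r => [|i r IH] HF.
  by exists 0; rewrite big_nil -[X in yform _ X](scale0r 0) yformZ scale0r.
have [p pE] := HF i (mem_head _ _).
have [|q qE] := IH; first by move=> j jr; apply: HF; rewrite inE jr orbT.
by exists (a i *: p + q); rewrite big_cons yformD yformZ pE qE.
Qed.

(** A root [a] of the dehomogenized polynomial gives the factor
    [y_0 - a y_1]; if its degree drops, [y_1] is a factor. *)
Lemma is_form_linear_factor k H : is_form k.+1 H -> exists a b H',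
  [/\ (a, b) <> (0, 0), is_form k H' & H = (a *: y0 + b *: y1) * H'].
Proof.
move=> [p ->]; rewrite yform_take; move: (take_poly _ p) (size_take_poly k.+2 p) => q sq.
have [sq'|sq'] := leqP (size q) k.+1.
  exists 0, 1, (yform k q); rewrite yform_small // scale0r add0r scale1r.
  split=> //; last by exists q.
  by move=> [/eqP]; rewrite oner_eq0.
have /closed_rootP [a /factor_theorem [r qE]] : size q != 1%N.
  by rewrite neq_ltn (leq_trans _ sq') ?orbT.
exists 1, (- a), (yform k r); split; [by move=> [/eqP]; rewrite oner_eq0|by exists r|].
have sr : (size r <= k.+1)%N.
  have r0 : r != 0 by apply: contraTneq sq' => r0; rewrite qE r0 mul0r size_poly0.
  by move: sq; rewrite qE size_Mmonic ?monicXsubC // size_XsubC addn2.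
have -> : q = r * 'X + (- a) *: r by rewrite qE -mul_polyC polyCN; ring.
by rewrite yformD yformMX yformZ yform_small // scale1r mulrDl scalerAl.
Qed.

(** The exponent of the monomial [y_0 ^ r_0 * y_1 ^ r_1 * y_2 ^ r_2]. *)
Definition mnm_form (r : 'I_3 -> nat) : 'X_{1..nb_vars t} :=
  (\sum_i mon_mnm t i *+ r i)%MM.

Lemma mnm_formE r i (j : 'I_(nvars t i)) : mnm_form r (vidx j) = (r i * expo j)%N.
Proof.
rewrite /mnm_form mnm_sumE (bigD1 i) //= mulmnE mon_mnmE eqxx big1 => [|k /negPf ki].
  by rewrite addn0 mulnC.
by rewrite mulmnE mon_mnmE ki.
Qed.

Lemma pi_mnm_form r : pi 'X_[mnm_form r] = \prod_i y i ^+ r i.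
Proof.
rewrite /mnm_form -mprodXE rmorph_prod; apply: eq_bigr => i _.
by rewrite -mpolyXn rmorphXn /= /tmon TmonE.
Qed.

Lemma mon_deg_mnm_form r :
  mon_deg (mnm_form r) = mon_deg (mon_mnm t ord0) *+ (\sum_i r i)%N :> K.
Proof.
rewrite /mnm_form -sumrMnr; elim/big_rec2: _ => [|i w m _ <-]; first exact: mon_deg0.
rewrite mon_degD; congr (_ + _); rewrite (mon_deg_mon_mnm t ord0 i).
by elim: (r i) => [|a IH]; rewrite ?mulm0n ?mon_deg0 ?mulr0n // mulmS mon_degD IH mulrS.
Qed.

Lemma is_form_mnm_form r : is_form (\sum_i r i) (pi 'X_[mnm_form r]).
Proof.
rewrite pi_mnm_form; elim/big_rec2: _ => [|i x k _ kx]; last exact: is_form_tmon_exp.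
by exists 1; rewrite /yform big_ord1 coef1 scale1r !expr0 mulr1.
Qed.

(** Divide a monomial of the given degree by the largest possible power of each
    [y_i], leaving [mbar].  Any other monomial of this degree differs from it by
    a combination of [l_0], [l_1], [l_2] with coefficients summing to zero; as
    some variable of each block has in [mbar] an exponent below [l_ij], it is
    again [mbar] times a monomial in the [y_i], of the same degree [k]. *)
Lemma component_forms (m0 : 'X_{1..nb_vars t}) : exists (mbar : 'X_{1..nb_vars t}) (k : nat),
  mon_deg mbar + mon_deg (mon_mnm t ord0) *+ k = mon_deg m0 :> K /\
  forall x : R, component (mon_deg m0) x -> exists2 H, is_form k H & x = pi 'X_[mbar] * H.
Proof.
have /choice [r rP] : forall i, exists r : nat,
    (forall j : 'I_(nvars t i), (r * expo j <= m0 (vidx j))%N) /\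
    exists j : 'I_(nvars t i), (m0 (vidx j) < r.+1 * expo j)%N.
  move=> i; case: (@arg_minnP _ (Ordinal (nvars_gt0 t i)) xpredT
    (fun j => m0 (vidx j) %/ expo j)%N isT) => j _ jmin.
  exists (m0 (vidx j) %/ expo j)%N; split=> [l|]; first by rewrite -leq_divRL ?expo_gt0 ?jmin.
  by exists j; rewrite ltn_ceil ?expo_gt0.
(* r i is the minimum over j of the quotients of m0 at T_ij by l_ij *)
pose mbar := (m0 - mnm_form r)%MM.
have m0E : m0 = (mbar + mnm_form r)%MM.
  rewrite submK //; apply/mnm_lepP => k; have [i [j ->]] := vidx_surj k.
  by rewrite mnm_formE (rP i).1.
exists mbar, (\sum_i r i)%N; split; first by rewrite [in RHS]m0E mon_degD mon_deg_mnm_form.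
have key m : mon_deg m = mon_deg m0 :> K -> exists2 r' : 'I_3 -> nat,
    (\sum_i r' i = \sum_i r i)%N & m = (mbar + mnm_form r')%MM.
  move=> /mon_deg_eqP [z z0 zE].
  have /choice [r' r'E] : forall i, exists r' : nat, (r' : int) = (r i)%:Z + z i.
    move=> i; have [j jP] := (rP i).2; have zij := zE i j; have e0 := expo_gt0 j.
    suff ge0 : (0 <= (r i)%:Z + z i)%R by exists (absz ((r i)%:Z + z i)); rewrite gez0_abs.
    move: jP e0 zij; move: (m _) (m0 _) (expo j) (r i) (z i) => a b e c v; clear => jP e0 zij.
    (* otherwise the exponent a of T_ij in m, below (c + 1 + v) * e, is negative *)
    rewrite leNgt; apply/negP => neg.
    have : (c%:Z + 1 + v) * e%:Z <= 0 by rewrite mulr_le0_ge0 //; lia.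
    have cE : c%:Z + 1 = c.+1%:Z by lia.
    have : (b%:Z < (c%:Z + 1) * e%:Z) by rewrite cE -PoszM.
    rewrite !mulrDl; lia.
  exists r'; last first.
    apply/mnmP => k; have [i [j ->]] := vidx_surj k.
    have := zE i j; rewrite [in X in X -> _]m0E !mnmDE !mnm_formE.
    by have := r'E i; nia.
  apply/eqP; rewrite -eqz_nat -!natz !natr_sum; apply/eqP.
  rewrite (eq_bigr (fun i => (r i)%:R + z i)) => [|i _].
    by rewrite big_split /= z0 addr0.
  by rewrite !natz r'E.
have key' (m : 'X_{1..nb_vars t}) : exists r' : 'I_3 -> nat,
    mon_deg m = mon_deg m0 :> K -> (\sum_i r' i = \sum_i r i)%N /\ m = (mbar + mnm_form r')%MM.
  have [/key [r' ? ?]|] := pselect (mon_deg m = mon_deg m0 :> K); first by exists r'.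
  by exists r.
have [rho rhoP] := choice key'.
move=> _ [f /allP fw ->].
exists (\sum_(m <- msupp f) f@_m *: pi 'X_[mnm_form (rho m)]).
  apply: is_form_sum => m /fw /eqP /rhoP [<- _]; exact: is_form_mnm_form.
rewrite [in LHS](mpolyE f) rmorph_sum mulr_sumr big_seq [RHS]big_seq; apply: eq_bigr => m mf.
have /fw /eqP /rhoP [_ mE] := mf.
by rewrite /= trin_piZ -trin_scalerAr -rmorphM -mpolyXD -mE.
Qed.
End Forms.

(** * Monomials in the variables of one block *)

Section BlockMonomials.
Variables (F : fieldType) (F_char0 : [pchar F] =i pred0) (t : trinomial_data).
Local Notation R := (trin_alg F t).
Local Notation pi := (@trin_pi F t).
Let domR := trin_domain F_char0 (t := t).

Definition tvar i (j : 'I_(nvars t i)) : R := pi (Tvar F j).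
Arguments tvar [i] j.

Inductive block_monomial i : R -> Prop :=
| BlockMonomial1 : block_monomial i 1
| BlockMonomialM (j : 'I_(nvars t i)) x : block_monomial i x -> block_monomial i (tvar j * x).

Lemma block_monomialM i x y :
  block_monomial i x -> block_monomial i y -> block_monomial i (x * y).
Proof. by elim=> [|j z _ IH] yi; rewrite ?mul1r // -mulrA; constructor; apply: IH. Qed.

Lemma block_monomialX i (j : 'I_(nvars t i)) e : block_monomial i (tvar j ^+ e).
Proof. by elim: e => [|e IH]; [constructor|rewrite exprS; constructor]. Qed.

Lemma block_monomial_prod i (Q : pred 'I_(nvars t i)) (e : 'I_(nvars t i) -> nat) :
  block_monomial i (\prod_(j | Q j) tvar j ^+ e j).
Proof.
apply: (big_ind (block_monomial i)); [constructor|exact: block_monomialM|].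
by move=> j _; apply: block_monomialX.
Qed.

Lemma block_monomial_neq0 i x : block_monomial i x -> x <> 0.
Proof.
elim=> [|j y _ y0]; first exact/eqP/oner_neq0.
by apply: (domain_neq0 domR) => //; apply: trin_var_neq0.
Qed.

(** By induction over its variables, [x] is a nonzerodivisor modulo every variable
    of block [k]; so the variables of [z] can be divided out one by one. *)
Lemma block_monomial_coprime i k x z a : i != k -> block_monomial i x -> block_monomial k z ->
  divides z (x * a) -> divides z a.
Proof.
move=> ik xi zk.
have var_regular l b : divides (tvar (i := k) l) (x * b) -> divides (tvar l) b.
  elim: xi b => [|j y _ IH] b; first by rewrite mul1r.
  by rewrite -mulrA => /(trin_var_regular ik); apply: IH.
elim: zk a => [|l y yk IH] a; first by move=> _; exists a; rewrite mul1r.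
move=> [e xaE]; have [|b aE] := var_regular l a; first by exists (y * e); rewrite xaE mulrA.
have [|f bE] := IH b; last by exists f; rewrite aE bE mulrA.
exists e; apply: (domain_mulI domR (@trin_var_neq0 F F_char0 t k l)).
by rewrite [RHS]mulrA -/(tvar l) -xaE aE; rewrite mulrCA.
Qed.

(** The quotient [y_i / T_ic], which is the derivative of [y_i] with respect to
    [T_ic] up to the factor [l_ic]. *)
Definition tder i (c : 'I_(nvars t i)) : R :=
  tvar c ^+ (expo c).-1 * \prod_(j | j != c) tvar j ^+ expo j.

Lemma tmon_split i (c : 'I_(nvars t i)) : tmon F t i = tvar c * tder c.
Proof.
rewrite /tmon /Tmon rmorph_prod (bigD1 c) //= /tder mulrA -exprS prednK ?expo_gt0 //.
by rewrite rmorphXn; congr (_ * _); apply: eq_bigr => j _; rewrite rmorphXn.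
Qed.

Lemma tder_block i (c : 'I_(nvars t i)) : block_monomial i (tder c).
Proof. by apply: block_monomialM; [exact: block_monomialX|exact: block_monomial_prod]. Qed.

Lemma tmon_neq0 i : tmon F t i <> 0.
Proof.
rewrite (tmon_split (Ordinal (nvars_gt0 t i))); apply: block_monomial_neq0.
by constructor; apply: tder_block.
Qed.

Lemma tderX i (c : 'I_(nvars t i)) : tder c = pi 'X_[mon_mnm t i - U_(vidx c)].
Proof.
apply: (domain_mulI domR (@trin_var_neq0 F F_char0 t i c)).
rewrite -/(tvar c) -tmon_split /tvar -rmorphM /Tvar -mpolyXD addmC submK ?lep1mP.
  by rewrite /tmon TmonE.
by rewrite mon_mnmE eqxx -lt0n expo_gt0.
Qed.

Lemma Tmon_mderiv i (c : 'I_(nvars t i)) :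
  pi ((Tmon F t i)^`M(vidx c)) = (expo c)%:R *: tder c.
Proof. by rewrite TmonE mderivX trin_piZ tderX mon_mnmE eqxx. Qed.

Lemma tvar_divides_tder i (c : 'I_(nvars t i)) : (1 < expo c)%N -> divides (tvar c) (tder c).
Proof.
move=> c1; rewrite /tder; apply: divides_mulr; exists (tvar c ^+ (expo c).-2).
by rewrite -exprS prednK // -ltnS prednK ?expo_gt0.
Qed.

Lemma tmon_divides_tder2 i (c : 'I_(nvars t i)) : (1 < expo c)%N ->
  divides (tmon F t i) (tder c * tder c).
Proof.
by move=> /tvar_divides_tder [e {1}->]; exists e; rewrite (tmon_split c); ring.
Qed.

Lemma divides_scale a z x : a != 0 -> divides z (a *: x : R) -> divides z x.
Proof.
move=> a0 [y xE]; exists (a^-1 *: y).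
by rewrite mulrC -scalerAl mulrC -xE scalerA mulVf // scale1r.
Qed.
End BlockMonomials.
Arguments tvar F [t i] j.

(** * Variables outside the kernel *)

Section KernelAnalysis.
Variables (F : closedFieldType) (F_char0 : [pchar F] =i pred0) (t : trinomial_data).
Local Notation R := (trin_alg F t).
Local Notation K := (grading_group t).
Local Notation tvar := (@tvar F t _).
Let domR := trin_domain F_char0 (t := t).
Let char0R := trin_char0 F_char0 (t := t).

Variable d : R -> R.
Hypotheses (dH : homogeneous_derivation d) (d_lnd : locally_nilpotent d).
Hypothesis d_neq0 : exists x, d x <> 0.

Let dD := derivation_add dH.
Let dM := derivation_leibniz dH.
Let dZ := derivation_scale dH.
Let dnil f : exists m, iter m d f = 0.
Proof. by have [m _ mf] := d_lnd f; exists m. Qed.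

Lemma kernel_divides x z : z <> 0 -> d z = 0 -> divides x z -> d x = 0.
Proof. exact: (d_kernel_divides domR char0R dD dM dnil). Qed.

Lemma order_exists x : x <> 0 -> exists m, d_order d x m.
Proof. exact: d_order_exists dnil x. Qed.

Lemma iterZ m a x : iter m d (a *: x) = a *: iter m d x.
Proof. by elim: m => //= m ->; rewrite dZ. Qed.

Variable w0 : K.
Hypothesis dw0 : forall w x, component w x -> component (w + w0) (d x).

Lemma iter_component w x a : component w x -> component (w + w0 *+ a) (iter a d x).
Proof.
move=> xw; elim: a => [|a IH]; first by rewrite mulr0n addr0.
by rewrite mulrSr addrA iterS; apply: dw0.
Qed.

Section SameBlock.
Variables (i : 'I_3) (j1 j2 : 'I_(nvars t i)).
Hypotheses (j12 : j1 != j2) (dj1 : d (tvar j1) <> 0) (dj2 : d (tvar j2) <> 0).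

Let c (k : 'I_(nb_vars t)) : int :=
  if k == vidx j1 then (expo j2)%:Z else if k == vidx j2 then - (expo j1)%:Z else 0.

Let vidx_neq : (vidx j2 == vidx j1) = false.
Proof. by rewrite eq_vidx eqxx; apply/negbTE; rewrite eq_sym. Qed.

Let cW k : \sum_(j < nvars t k) c (vidx j) * (expo j)%:Z = 0.
Proof.
have [ik|ik] := eqVneq i k; last first.
  by rewrite big1 // => j _; rewrite /c !eq_vidx ![k == i]eq_sym (negPf ik) mul0r.
case: k / ik; rewrite (bigD1 j1) //= (bigD1 j2) 1?eq_sym //= big1 => [|j /andP [jj1 jj2]].
  by rewrite /c eqxx vidx_neq eqxx; ring.
rewrite /c !eq_vidx eqxx /= ![_ == _ :> nat](inj_eq val_inj).
by rewrite (negPf jj1) (negPf jj2) mul0r.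
Qed.

(** Only [T_ij1] has positive weight, so a homogeneous element of positive weight
    is divisible by it, and this is impossible for an element of the kernel;
    negative weights are excluded in the same way by [T_ij2]. *)
Lemma kernel_weight0 w x : component w x -> x <> 0 -> d x = 0 -> weight c w = 0.
Proof.
move=> xw x0 dx; case: (ltgtP (weight c w) 0) => // wc.
- case: dj2; apply: (kernel_divides x0 dx); apply: (component_divides xw) => m mw mj.
  move: wc; rewrite -mw (weight_mon_deg cW) ltNge => /negP; apply.
  apply: sumr_ge0 => k _; rewrite /c; case: eqP => [->|_]; first by lia.
  by case: eqP => [->|_]; rewrite ?mj ?mulr0 ?mul0r.
- case: dj1; apply: (kernel_divides x0 dx); apply: (component_divides xw) => m mw mj.
  move: wc; rewrite -mw (weight_mon_deg cW) ltNge => /negP; apply.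
  apply: sumr_le0 => k _; rewrite /c; case: eqP => [->|_]; first by rewrite mj mulr0.
  by case: eqP => _; rewrite ?mul0r //; lia.
Qed.

(** The last nonzero iterate of [d] on [T_ij] lies in the kernel, so its weight,
    which is that of [T_ij] plus a multiple of the weight of [w0], vanishes.  The
    two variables have weights of opposite sign. *)
Lemma same_block_kernel : False.
Proof.
have last_iter (j : 'I_(nvars t i)) : d (tvar j) <> 0 ->
    exists a, c (vidx j) + weight c w0 *+ a = 0.
  move=> dj; have [|a ja] := @order_exists (tvar j).
    by move=> j0; apply: dj; rewrite j0 (leibniz0 dD).
  exists a; have [h0 hd] := d_order_iter ja.
  have Tw : component (mon_deg U_(vidx j)%MM : K) (tvar j) by apply: componentX.
  have := kernel_weight0 (iter_component a Tw) h0 hd.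
  by rewrite (weightD cW) (weightMn cW) (weight_var cW).
have [a] := last_iter j1 dj1; have [b] := last_iter j2 dj2.
rewrite /c eqxx vidx_neq eqxx -(mulr_natr _ a) -(mulr_natr _ b) !natz.
move: (weight c w0) (expo_gt0 j1) (expo_gt0 j2) => v e1 e2 E1 E2.
have [v0|v0] := ltP v 0.
  have : v * b%:Z <= 0 by rewrite mulr_le0_ge0 // ltW.
  by lia.
have : 0 <= v * a%:Z by rewrite mulr_ge0.
by lia.
Qed.
End SameBlock.

Lemma at_most_one_active i : exists c : 'I_(nvars t i), forall j, j != c -> d (tvar j) = 0.
Proof.
have [[c dc]|H] := pselect (exists c : 'I_(nvars t i), d (tvar c) <> 0).
  exists c => j jc; apply: contrapT => dj; exact: (same_block_kernel jc dj dc).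
exists (Ordinal (nvars_gt0 t i)) => j _; apply: contrapT => dj; by apply: H; exists j.
Qed.
End KernelAnalysis.

(** * Shape of homogeneous locally nilpotent derivations *)

Section ActiveVariables.
Variables (F : closedFieldType) (F_char0 : [pchar F] =i pred0) (t : trinomial_data).
Local Notation R := (trin_alg F t).
Local Notation K := (grading_group t).
Local Notation pi := (@trin_pi F t).
Local Notation tvar := (@tvar F t _).
Local Notation y := (tmon F t).
Let domR := trin_domain F_char0 (t := t).
Let char0R := trin_char0 F_char0 (t := t).

Variable d : R -> R.
Hypotheses (dH : homogeneous_derivation d) (d_lnd : locally_nilpotent d).
Hypothesis d_neq0 : exists x, d x <> 0.

Let dD := derivation_add dH.
Let dM := derivation_leibniz dH.
Let dZ := derivation_scale dH.
Let dnil f : exists m, iter m d f = 0.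
Proof. by have [m _ mf] := d_lnd f; exists m. Qed.
Let kernel_div := kernel_divides F_char0 dH d_lnd.

Variable w0 : K.
Hypothesis dw0 : forall w x, component w x -> component (w + w0) (d x).

Variable C : forall i, 'I_(nvars t i).
Hypothesis dC : forall i (j : 'I_(nvars t i)), j != C i -> d (tvar j) = 0.

Local Notation x i := (tvar (C i)).
Local Notation E i := (tder F (C i)).
Local Notation u i := (d (x i)).

Lemma d_tmon i : d (y i) = (expo (C i))%:R *: (E i * u i).
Proof.
rewrite (tmon_split F (C i)) dM /tder.
set M := \prod_(j | _) _.
have dMon : d M = 0.
  apply: (big_ind (fun z => d z = 0)); first exact: leibniz1 dM.
    by move=> a b da db; rewrite dM da db mul0r mulr0 addr0.
  move=> j jC; case: (expo j) => [|e]; first exact: leibniz1 dM.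
  by rewrite (leibnizXn dM) dC // !mulr0.
rewrite dM dMon mulr0 addr0.
have := expo_gt0 (C i); case: (expo (C i)) => // -[|e] _ /=.
  by rewrite expr0 (leibniz1 dM) scale1r; ring.
rewrite (leibnizXn dM) -[e.+2]addn1 natrD scalerDl scale1r scaler_nat exprS -[in RHS]mulr_natl.
by ring.
Qed.

Lemma E_neq0 i : E i <> 0.
Proof. exact: (block_monomial_neq0 F_char0 (tder_block F (C i))). Qed.

Lemma expo_neq0 i : (expo (C i))%:R != 0 :> F.
Proof. by rewrite (pcharf0P F).1 // -lt0n expo_gt0. Qed.

Lemma scale_neq0 (a : F) (z : R) : a != 0 -> z <> 0 -> a *: z <> 0.
Proof.
move=> a0 z0 az; apply: z0; have := congr1 ( *:%R a^-1) az.
by rewrite scalerA mulVf // scale1r scaler0.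
Qed.

Lemma d_tmon_neq0 i : u i <> 0 -> d (y i) <> 0.
Proof.
move=> ui; rewrite d_tmon; apply: scale_neq0; first exact: expo_neq0.
by apply: (domain_neq0 domR) => //; apply: E_neq0.
Qed.

Lemma d_tmon_sum : \sum_i d (y i) = 0.
Proof. by rewrite -(big_morph d dD (leibniz0 dD)) tmon_sum (leibniz0 dD). Qed.

(** In terms of [E] and [u] the relation says that [E_k] divides [E_i * u_i] up
    to a nonzero scalar, and [E_i], [E_k] are monomials in different blocks. *)
Lemma relation_divides i k (a b : F) : i != k -> a != 0 ->
  a *: d (y i) + b *: d (y k) = 0 -> divides (E k) (u i).
Proof.
move=> ik a0 /eqP; rewrite addr_eq0 !d_tmon => /eqP H.
apply: (divides_scale (expo_neq0 i)); apply: (divides_scale a0).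
rewrite scalerA.
apply: (block_monomial_coprime F_char0 ik (tder_block F (C i)) (tder_block F (C k))).
exists (- (b * (expo (C k))%:R) *: u k).
rewrite -!trin_scalerAr -scalerA H scaleNr.
by rewrite scalerA.
Qed.

(** If both exponents exceed 1, [y_i] divides [E_i ^ 2] and [y_k] divides
    [E_k ^ 2].  Since [E_k] divides [u_i] and [E_i] divides [u_k], the product
    [d y_i * d y_k] is a multiple of [E_i ^ 2 * E_k ^ 2], hence of [y_i * y_k],
    although its degree for [d] is smaller by 2. *)
Lemma proportional_expo i k (a b : F) : i != k -> u i <> 0 -> u k <> 0 ->
  (a, b) <> (0, 0) -> a *: d (y i) + b *: d (y k) = 0 ->
  expo (C i) = 1%N \/ expo (C k) = 1%N.
Proof.
move=> ik ui uk ab H.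
have yi := d_tmon_neq0 ui; have yk := d_tmon_neq0 uk.
have a0 : a != 0.
  apply/eqP => a0; move: H; rewrite a0 scale0r add0r; apply: scale_neq0 => //.
  by apply/eqP => b0; apply: ab; rewrite a0 b0.
have b0 : b != 0.
  by apply/eqP => b0; move: H; rewrite b0 scale0r addr0; apply: scale_neq0.
have [e uiE] := relation_divides ik a0 H.
have [f ukE] : divides (E i) (u k).
  by apply: (@relation_divides k i b a) => //; [rewrite eq_sym|rewrite addrC].
have [l1|li] := leqP (expo (C i)) 1; first by left; have := expo_gt0 (C i); lia.
have [l1|lk] := leqP (expo (C k)) 1; first by right; have := expo_gt0 (C k); lia.
exfalso.
have [p pE] := tmon_divides_tder2 F li; have [q qE] := tmon_divides_tder2 F lk.
have [n ni] := d_order_pos dD dnil yi; have [o ok] := d_order_pos dD dnil yk.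
have yy : divides (y i * y k) (d (y i) * d (y k)).
  have di : d (y i) = (expo (C i))%:R%:A * (E i * u i) by rewrite mulr_algl d_tmon.
  have dk : d (y k) = (expo (C k))%:R%:A * (E k * u k) by rewrite mulr_algl d_tmon.
  rewrite di dk uiE ukE; move: (_%:A) (_%:A) => ai ak.
  exists (ai * ak * e * f * (p * q)).
  transitivity (ai * ak * e * f * ((E i * E i) * (E k * E k))); first by ring.
  by rewrite pE qE; ring.
have := d_order_divides domR char0R dD dM dnil yy
  (d_order_mul domR char0R dD dM ni ok)
  (d_order_mul domR char0R dD dM (d_order_d ni) (d_order_d ok)).
by lia.
Qed.

Section OneIdleBlock.
Variable i0 : 'I_3.
Hypothesis idle : u i0 = 0.

Lemma idle_relation i k : i != i0 -> k != i0 -> i != k -> d (y i) + d (y k) = 0.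
Proof.
move=> ii0 ki0 ik; have := d_tmon_sum.
rewrite (ord3_sum (fun i => d (y i)) ik (r := i0)) ?[i0 == _]eq_sym //.
by rewrite [d (y i0)]d_tmon idle mulr0 scaler0 addr0.
Qed.

(** If a second [u_i] vanishes, so do [d y_i] and therefore the third [d y_k]:
    then [d] kills all variables. *)
Lemma idle_active i : i != i0 -> u i <> 0.
Proof.
move=> ii0 ui; have i0i : i0 != i by rewrite eq_sym.
have [k [ki0 ki kP]] := ord3_third i0i.
have uk : u k = 0.
  apply: contrapT => /d_tmon_neq0; apply.
  have ik : i != k by rewrite eq_sym.
  by have := idle_relation ii0 ki0 ik; rewrite [d (y i)]d_tmon ui mulr0 scaler0 add0r.
have [z] := d_neq0; apply; apply: (derivation_ext dH.1 (zero_derivation F t)) => x j.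
have ux : u x = 0.
  have [->//|xi0] := eqVneq x i0; have [->//|xi] := eqVneq x i.
  by rewrite (kP x).
by have [->|/dC] := eqVneq j (C x).
Qed.

Lemma idle_divides i k : i != i0 -> k != i0 -> i != k -> divides (E k) (u i).
Proof.
move=> ii0 ki0 ik; apply: (@relation_divides i k 1 1) => //; first exact: oner_neq0.
by rewrite !scale1r; apply: idle_relation.
Qed.

(** An exponent above 1 lets [x_i] divide [E_i], hence [u_k]; if this happens
    for both blocks, [x_i] and [x_k] divide each other's derivatives. *)
Lemma idle_expo i k : i != i0 -> k != i0 ->
  (1 < expo (C i))%N -> (1 < expo (C k))%N -> i = k.
Proof.
move=> ii0 ki0 li lk; apply: contrapT => /eqP ik; have ki : k != i by rewrite eq_sym.
have ik' : divides (x k) (u i).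
  by apply: divides_trans (idle_divides ii0 ki0 ik); apply: tvar_divides_tder.
have ki' : divides (x i) (u k).
  by apply: divides_trans (idle_divides ki0 ii0 ki); apply: tvar_divides_tder.
have [] := d_cross_divides domR char0R dD dM dnil ki' ik'; exact: idle_active.
Qed.

(** The coefficient [h] is read off from [u_i1], a multiple of [E_i2]; the
    relation between the two blocks then determines [u_i2].  Finally [h] lies
    in the kernel because it divides [d h = h * delta h]. *)
Theorem idle_elementary : elementary_type_II d.
Proof.
have [i1 i10] : exists i1, i0 != i1.
  by exists (if i0 == ord0 then ord_max else ord0); case: (eqVneq i0 ord0) => [->|].
have [i2 [i20 i21 i2P]] := ord3_third i10.
have i12 : i1 != i2 by rewrite eq_sym.
have i1i0 : i1 != i0 by rewrite eq_sym.
pose D i : R := pi ((Tmon F t i)^`M(vidx (C i))).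
have DE i : D i = (expo (C i))%:R *: E i by exact: Tmon_mderiv.
have D0 i : D i <> 0.
  by rewrite DE; apply: scale_neq0; [exact: expo_neq0|exact: E_neq0].
have dyD i : d (y i) = D i * u i by rewrite d_tmon DE scalerAl.
have [e ueE] := idle_divides i1i0 i20 i12.
(* delta_val involves the full derivative l_i2 * E_i2 of y_i2 *)
pose h : R := (expo (C i2))%:R^-1 *: e.
have u1 : u i1 = D i2 * h.
  rewrite ueE DE /h -scalerAl -trin_scalerAr scalerA mulfV ?scale1r //.
  exact: expo_neq0.
have u2 : u i2 = - (D i1 * h).
  apply: (domain_mulI domR (@D0 i2)); have := idle_relation i1i0 i20 i12.
  by rewrite !dyD u1 addrC => /eqP; rewrite addr_eq0 => /eqP ->; ring.
pose beta (i : 'I_3) : F := if i == i0 then 0 else if i == i1 then 1 else -1.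
have beta0 i : (beta i == 0) = (i == i0).
  rewrite /beta; case: (i == i0); rewrite ?eqxx //.
  by case: (i == i1); rewrite ?oppr_eq0 oner_eq0.
have beta_sum : \sum_i beta i = 0.
  rewrite (ord3_sum beta i10 i20 i21) /beta !eqxx (negPf i1i0) (negPf i20) (negPf i21).
  by rewrite add0r subrr.
have val0 : delta_val C beta i0 = 0 by rewrite /delta_val /beta eqxx scale0r.
have val1 : pi (delta_val C beta i1) = D i2.
  rewrite /delta_val (big_pred1 i2) => [|k]; last first.
    rewrite beta0 /=; have [->|ki1] := eqVneq k i1; first by rewrite (negPf i12).
    have [->|ki0] := eqVneq k i0; first by rewrite [_ == i2]eq_sym (negPf i20) andbF.
    by rewrite (i2P k) // eqxx.
  by rewrite /beta (negPf i1i0) eqxx scale1r.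
have val2 : pi (delta_val C beta i2) = - D i1.
  rewrite /delta_val (big_pred1 i1) => [|k]; last first.
    rewrite beta0 /=; have [->|ki2] := eqVneq k i2; first by rewrite (negPf i21).
    have [->|ki0] := eqVneq k i0; first by rewrite [_ == i1]eq_sym (negPf i1i0) andbF.
    by apply/esym/eqP; apply: contrapT => /eqP ki1; move: ki2; rewrite (i2P k) ?eqxx.
  by rewrite /beta (negPf i20) (negPf i21) trin_piZ scaleN1r.
have dE z : d z = h * delta C beta z.
  apply: (derivation_ext dH.1 (e := fun z => h * delta C beta z)) => [|i j].
    have [deltaL deltaM] := delta_derivation C beta_sum; split=> [a v w|v w].
      by rewrite deltaL mulrDr -trin_scalerAr.
    by rewrite deltaM; ring.
  rewrite deltaT //; have [->|/dC ->] := eqVneq j (C i); last by rewrite mulr0.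
  have [->|ii0] := eqVneq i i0; first by rewrite val0 rmorph0 mulr0.
  have [->|ii1] := eqVneq i i1; first by rewrite val1 mulrC.
  by rewrite (i2P i) // val2 [RHS]mulrN mulrC.
have h0 : h <> 0.
  by move=> h0; apply: (idle_active i1i0); rewrite u1 h0 mulr0.
exists C, beta, h; split=> //.
- split=> //; exists i0; split=> [i|]; last exact: idle_expo.
  by split=> [/eqP|->]; [rewrite beta0 => /eqP|apply/eqP; rewrite beta0].
- have := dw0 (componentX F (U_(vidx (C i1)))%MM).
  rewrite -[d _]/(u i1) u1 DE -scalerAl trin_scalerAr (tderX F_char0).
  move=> /(component_div F_char0) hw.
  exists (mon_deg U_(vidx (C i1)) + w0 - mon_deg (mon_mnm t i2 - U_(vidx (C i2)))).
  have := componentZ (expo (C i2))%:R^-1 hw.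
  by rewrite scalerA mulVf ?scale1r // expo_neq0.
- have dh : d h = 0.
    apply: (d_self_divides domR char0R dD dM dnil).
    by exists (delta C beta h); rewrite dE.
  by move: dh; rewrite dE => /domR [].
Qed.
End OneIdleBlock.
Section AllBlocksActive.
Hypothesis active : forall i, u i <> 0.

(* Each [x_i] gets the product of the two other active exponents as its weight,
   so that all [y_i] have the same positive weight [W] and the kernel variables
   weight 0. *)
Let co (i : 'I_3) : int := \prod_(k | k != i) (expo (C k))%:Z.
Let W : int := \prod_k (expo (C k))%:Z.
Let c (k : 'I_(nb_vars t)) : int := \sum_i co i *+ (k == vidx (C i)).

Let cE i (j : 'I_(nvars t i)) : c (vidx j) = co i *+ (j == C i).
Proof.
rewrite /c (bigD1 i) //= big1 ?addr0 => [|k ki]; first by rewrite eq_vidx eqxx.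
by rewrite eq_vidx eq_sym (negPf ki).
Qed.

Let cW i : \sum_(j < nvars t i) c (vidx j) * (expo j)%:Z = W.
Proof.
rewrite (bigD1 (C i)) //= big1 ?addr0 => [|j /negPf jC]; last by rewrite cE jC mul0r.
by rewrite cE eqxx mulr1n /W (bigD1 i) //= mulrC.
Qed.

Let W_neq0 : W != 0.
Proof.
by rewrite /W; apply/prodf_neq0 => k _; rewrite eqz_nat -lt0n expo_gt0.
Qed.

Let avoids (m : 'X_{1..nb_vars t}) := forall i, m (vidx (C i)) = 0%N.

Lemma weight_avoids m : avoids m -> weight c (mon_deg m) = 0.
Proof.
move=> mC; rewrite (weight_mon_deg cW) big1 // => k _; rewrite /c mulr_suml big1 // => i _.
by case: eqP => [->|_]; rewrite ?mC ?mulr0 ?mul0r.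
Qed.

Lemma active_monomial m : d (pi 'X_[m]) = 0 -> avoids m.
Proof.
move=> dm i; apply: contrapT => mi; apply: (active (i := i)).
apply: (kernel_div (pi_monomial_neq0 F_char0 (m := m)) dm).
have [q qE] : divides ('X_(vidx (C i))) ('X_[m] : {mpoly F[nb_vars t]}) by apply/divides_varX.
by exists (pi q); rewrite qE rmorphM.
Qed.

Let form a b : R := a *: y ord0 + b *: y idx1.

(** Write the element as a monomial times a form of degree [k]: for [k > 0] the
    form has a linear factor, which lies in the kernel; for [k = 0] the element
    is a multiple of a monomial, whose variables lie in the kernel. *)
Lemma kernel_linear_or_monomial w z : component w z -> z <> 0 -> d z = 0 ->
  (exists a b, (a, b) <> (0, 0) /\ d (form a b) = 0) \/
  exists a m, [/\ z = a *: pi 'X_[m], mon_deg m = w & avoids m].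
Proof.
move=> zw z0 dz; have [f fw zE] := zw.
case E : (msupp f) => [|m0 s].
  by case: z0; move/eqP: E; rewrite msupp_eq0 zE => /eqP ->; rewrite rmorph0.
have m0w : mon_deg m0 = w by move: fw; rewrite /mpoly_component E /= => /andP [/eqP].
have [mbar [k [degE]]] := component_forms F m0.
rewrite m0w in degE * => /(_ z zw) [H HF zE'].
case: k degE HF => [|k] degE HF; last first.
  left; have [a [b [H' [ab _ HE]]]] := is_form_linear_factor HF.
  exists a, b; split=> //; apply: (kernel_div z0 dz).
  by exists (pi 'X_[mbar] * H'); rewrite zE' HE mulrCA.
right; have [p HE] := HF; exists p`_0, mbar; split.
- rewrite zE' HE /yform big_ord1 -trin_scalerAr !expr0 !mulr1.
  by [].
- by rewrite -degE mulr0n addr0.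
by apply: active_monomial; apply: (kernel_div z0 dz); exists H.
Qed.

Lemma component_form a b : component (mon_deg (mon_mnm t ord0)) (form a b).
Proof.
have yc i : component (mon_deg (mon_mnm t ord0)) (y i).
  by rewrite (mon_deg_mon_mnm t ord0 i) /tmon TmonE; apply: componentX.
by apply: componentD; apply: componentZ.
Qed.

(** Suppose that no linear form lies in the kernel.  The last nonzero iterate of
    [d] on a linear form is then a multiple of a kernel monomial, of weight 0,
    so that [W + N * wt w0 = 0] gives all linear forms the same degree [N] for
    [d].  For [y_0] and [y_1] these monomials have the same degree in the
    grading group and avoid all [x_i], so they coincide; hence [d ^ N] kills a
    linear combination of [y_0] and [y_1], a contradiction. *)
Lemma linear_kernel : exists a b, (a, b) <> (0, 0) /\ d (form a b) = 0.
Proof.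
apply: contrapT => noL.
have last_iter a b : form a b <> 0 -> exists N e m,
    [/\ d_order d (form a b) N, iter N d (form a b) = e *: pi 'X_[m],
        mon_deg m = mon_deg (mon_mnm t ord0) + w0 *+ N & avoids m].
  move=> ab; have [N aN] := d_order_exists dnil ab; exists N.
  have [h0 hd] := d_order_iter aN.
  have [//|[e [m [hE mw mC]]]] :=
    kernel_linear_or_monomial (iter_component dw0 N (component_form a b)) h0 hd.
  by exists e, m.
have same_order N N' m m' : avoids m -> avoids m' ->
    mon_deg m = mon_deg (mon_mnm t ord0) + w0 *+ N ->
    mon_deg m' = mon_deg (mon_mnm t ord0) + w0 *+ N' -> N = N'.
  move=> /weight_avoids + /weight_avoids + mN mN'.
  rewrite mN mN' !(weightD cW) !(weightMn cW) (weight_mon_mnm cW) => /eqP.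
  rewrite addr_eq0 => /eqP WE /eqP; rewrite addr_eq0 WE eqr_opp => /eqP.
  have wt0 : weight c w0 != 0.
    by apply/eqP => wt0; move: W_neq0; rewrite WE wt0 mul0rn oppr0 eqxx.
  by move/(mulrIn wt0).
have form10 : form 1 0 = y ord0 by rewrite /form scale1r scale0r addr0.
have form01 : form 0 1 = y idx1 by rewrite /form scale1r scale0r add0r.
have [|N [e [m [_ hE mw mC]]]] := last_iter 1 0.
  by rewrite form10; apply: tmon_neq0.
have [|N' [e' [m' [oN' hE' mw' mC']]]] := last_iter 0 1.
  by rewrite form01; apply: tmon_neq0.
have NN := same_order _ _ _ _ mC mC' mw mw'; subst N'.
have mm : m = m'.
  have /mon_deg_eqP [z z0 zE] : mon_deg m = mon_deg m' :> K by rewrite mw mw'.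
  have zi i : z i = 0.
    have := zE i (C i); rewrite mC mC' add0r => /esym/eqP; rewrite mulf_eq0 => /orP [/eqP //|].
    by rewrite eqz_nat (gtn_eqF (expo_gt0 _)).
  apply/mnmP => k; have [i [j ->]] := vidx_surj k.
  by have := zE i j; rewrite zi mul0r addr0 => -[].
(* e' y_0 - e y_1 is killed by the N-th iterate *)
have e'0 : e' <> 0.
  by move=> e'0; have [] := oN'; rewrite hE' e'0 scale0r.
have iterL : iter N d (form e' (- e)) = 0.
  rewrite /form (iter_morphD dD) !(iterZ dH) -form10 -form01 hE hE' mm !scalerA.
  by rewrite -scalerDl mulNr [e' * e]mulrC subrr scale0r.
have [L0|/eqP L0] := eqVneq (form e' (- e)) 0.
  by apply: noL; exists e', (- e); split; [move=> [] /e'0|rewrite L0 (leibniz0 dD)].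
have [N'' [f [m'' [oN'' _ mw'' mC'']]]] := last_iter _ _ L0.
have NN := same_order _ _ _ _ mC mC'' mw mw''; subst N''.
by have [] := oN''.
Qed.

(** By [linear_kernel] and [y_0 + y_1 + y_2 = 0], the derivatives of any two of
    the [y_i] are proportional, so that at most one [x_i] has an exponent above
    1. *)
Lemma active_linear_blocks : exists p q : 'I_3,
  [/\ p != q, expo (C p) = 1%N & expo (C q) = 1%N].
Proof.
have [a [b [ab dab]]] := linear_kernel.
have one_linear i k : i != k -> expo (C i) = 1%N \/ expo (C k) = 1%N.
  move=> ik; have [r [ri rk _]] := ord3_third ik.
  pose bb (i : 'I_3) : F := if i == ord0 then a else if i == idx1 then b else 0.
  apply: (@proportional_expo i k (bb i - bb r) (bb k - bb r)) => //.
    move=> [/eqP + /eqP]; rewrite !subr_eq0 => /eqP bi /eqP bk.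
    (* equal coefficients on i, k and r are all equal to the coefficient 0 of y_2 *)
    have bx x : bb x = bb idx2.
      have rP : forall x, bb x = bb r.
        have [r' [_ _ rP']] := ord3_third ik => z.
        have [->//|zi] := eqVneq z i; have [->//|zk] := eqVneq z k.
        by rewrite (rP' z) // (rP' r).
      by rewrite !rP.
    by apply: ab; rewrite -[a]/(bb ord0) -[b]/(bb idx1) !bx.
  have sum0 : \sum_x bb x *: d (y x) = 0.
    have i12 : ord0 != idx1 by [].
    rewrite (ord3_sum _ i12 (r := idx2)) // /bb /= scale0r addr0.
    by rewrite -!dZ -dD.
  have := d_tmon_sum; rewrite (ord3_sum (fun i => d (y i)) ik ri rk) => sum1.
  move: sum0; rewrite (ord3_sum _ ik ri rk) => sum0.
  rewrite !scalerBl; transitivity (bb i *: d (y i) + (bb k *: d (y k) + bb r *: d (y r)) -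
    bb r *: (d (y i) + (d (y k) + d (y r)))); last by rewrite sum0 sum1 scaler0 subrr.
  by rewrite !scalerDr; ring.
have [p1|p2] := one_linear ord0 idx1 isT.
  have [q1|q2] := one_linear idx1 idx2 isT; first by exists ord0, idx1.
  by exists ord0, idx2.
have [q1|q2] := one_linear ord0 idx2 isT; first by exists ord0, idx1.
by exists idx1, idx2.
Qed.
End AllBlocksActive.
End ActiveVariables.

Theorem corollary1 (F : closedFieldType) (F_char0 : [pchar F] =i pred0)
    (t : trinomial_data)
    (nonlinear : forall i, (1 < nvars t i * expo1 t i)%N)
    (nonfactorial : ~ factorial_ring (trin_alg F t))
    (d : trin_alg F t -> trin_alg F t) (d_homog : homogeneous_derivation d)
    (d_lnd : locally_nilpotent d) (d_neq0 : exists x, d x <> 0) :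
  elementary_type_II d.
Proof.
have [w0 dw0] := homogeneous_shift F_char0 d_homog d_neq0.
pose active i := cid (at_most_one_active F_char0 d_homog d_lnd dw0 i).
pose C i := projT1 (active i).
have dC i (j : 'I_(nvars t i)) : j != C i -> d (tvar F j) = 0.
  exact: (projT2 (active i)).
have [[i0 idle]|all_active] := pselect (exists i0, d (tvar F (C i0)) = 0).
  exact: (idle_elementary F_char0 d_homog d_lnd d_neq0 dw0 dC idle).
case: nonfactorial.
have [|p [q [pq p1 q1]]] := active_linear_blocks F_char0 d_homog d_lnd dw0 dC.
  by move=> i di; apply: all_active; exists i.
exact: (trinomial_factorial F_char0 pq p1 q1).
Qed.
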